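(* Work in $\mathrm{ZFU}$. Assume that cardinality is parametrically definable and that Plenitude$^+$ holds. Then the Collection Principle is equivalent to the Reflection Principle (RP).
   Context: $\mathrm{ZFU}$ is ZF set theory with urelements. Its language has $\in$ and a unary predicate $\mathscr{A}$ for urelements; $\mathscr{A}$ also denotes the class of all urelements. A set is an object that is not an urelement. The axioms are Foundation, Pairing, Union, Powerset, Infinity, the Separation schema, the Replacement schema (but not Collection), Extensionality for sets only, and the axiom that no urelement has members. The urelements may form a proper class. $x\sim y$ means there is a bijection between the sets $x$ and $y$. Plenitude$^+$: for every set $x$ there is a set $A$ of urelements with $x\sim A$. Cardinality is parametrically definable if there are a formula $\varphi$ and an object $p$ such that $\varphi(x,|x|,p)$ defines a class function $x\mapsto |x|$ on sets such that for all sets $x,y$: $x\sim y$ if and only if $|x|=|y|$. Collection (schema, for each formula $\varphi$): $\forall w,u\,(\forall x\in w\,\exists y\,\varphi(x,y,u)\to\exists v\,\forall x\in w\,\exists y\in v\,\varphi(x,y,u))$. RP (schema, for each formula $\varphi$): for every set $x$ there is a transitive set $t$ with $x\subseteq t$ such that for all $x_1,\dots,x_n\in t$, $\varphi(x_1,\dots,x_n)\leftrightarrow\varphi^t(x_1,\dots,x_n)$, where $\varphi^t$ is the relativization of $\varphi$ to $t$. Equivalence of the two schemas means: all instances of one hold if and only if all instances of the other hold. *)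

(* Defs.v *)
Set Implicit Arguments.
Unset Strict Implicit.

(** First-order formulas in the language with [∈], [=] and the urelement
    predicate.  Variables are de Bruijn indices: under a quantifier, index 0 is
    the bound variable and the outer variables are shifted by one. *)
Inductive formula : Type :=
| fMem (i j : nat)
| fEq (i j : nat)
| fUr (i : nat)
| fFalse
| fImp (f g : formula)
| fAnd (f g : formula)
| fOr (f g : formula)
| fAll (f : formula)
| fEx (f : formula).

Fixpoint vars_below (n : nat) (f : formula) : Prop :=
  match f with
  | fMem i j | fEq i j => i < n /\ j < n
  | fUr i => i < n
  | fFalse => True
  | fImp g h | fAnd g h | fOr g h => vars_below n g /\ vars_below n h
  | fAll g | fEx g => vars_below (S n) g
  end.

(** [relativize k f] is [f^t], where [t] is the value of the variable [k];
    [k] should not be free in [f]. *)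
Fixpoint relativize (k : nat) (f : formula) : formula :=
  match f with
  | fMem _ _ | fEq _ _ | fUr _ | fFalse => f
  | fImp g h => fImp (relativize k g) (relativize k h)
  | fAnd g h => fAnd (relativize k g) (relativize k h)
  | fOr g h => fOr (relativize k g) (relativize k h)
  | fAll g => fAll (fImp (fMem 0 (S k)) (relativize (S k) g))
  | fEx g => fEx (fAnd (fMem 0 (S k)) (relativize (S k) g))
  end.

Record structure : Type := {
  carrier :> Type;
  mem : carrier -> carrier -> Prop;
  ur : carrier -> Prop
}.

Arguments mem {s} x y.
Arguments ur {s} x.

Notation "x '∈' y" := (mem x y) (at level 70, no associativity).
Notation "x '∉' y" := (~ mem x y) (at level 70, no associativity).

Definition scons (T : Type) (a : T) (r : nat -> T) (i : nat) : T :=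
  match i with O => a | S j => r j end.

Fixpoint sat (M : structure) (r : nat -> M) (f : formula) : Prop :=
  match f with
  | fMem i j => r i ∈ r j
  | fEq i j => r i = r j
  | fUr i => ur (r i)
  | fFalse => False
  | fImp g h => sat r g -> sat r h
  | fAnd g h => sat r g /\ sat r h
  | fOr g h => sat r g \/ sat r h
  | fAll g => forall a : M, sat (scons a r) g
  | fEx g => exists a : M, sat (scons a r) g
  end.

(** [sat3 f x y u] is [f(x, y, u)] for [f] with [vars_below 3 f]; the values
    given to the variables from 3 on are then irrelevant. *)
Definition sat3 (M : structure) (f : formula) (x y u : M) : Prop :=
  sat (scons x (scons y (fun _ => u))) f.

Definition is_set (M : structure) (x : M) : Prop := ~ ur x.

Definition sub (M : structure) (x y : M) : Prop := forall z : M, z ∈ x -> z ∈ y.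

Definition transitive (M : structure) (t : M) : Prop :=
  forall y z : M, y ∈ t -> z ∈ y -> z ∈ t.

Definition is_upair (M : structure) (p a b : M) : Prop :=
  forall z : M, z ∈ p <-> z = a \/ z = b.

(** [p] is the Kuratowski pair [{{a}, {a, b}}]. *)
Definition is_opair (M : structure) (p a b : M) : Prop :=
  exists s d : M, is_upair s a a /\ is_upair d a b /\ is_upair p s d.

Definition maps_to (M : structure) (f a b : M) : Prop :=
  exists p : M, p ∈ f /\ is_opair p a b.

Definition bijection (M : structure) (f x y : M) : Prop :=
  is_set f /\
  (forall p : M, p ∈ f -> exists a b : M, a ∈ x /\ b ∈ y /\ is_opair p a b) /\
  (forall a : M, a ∈ x -> exists! b : M, b ∈ y /\ maps_to f a b) /\
  (forall b : M, b ∈ y -> exists! a : M, a ∈ x /\ maps_to f a b).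

Definition equinumerous (M : structure) (x y : M) : Prop :=
  exists f : M, bijection f x y.

Definition Foundation (M : structure) : Prop :=
  forall x : M, (exists y : M, y ∈ x) ->
  exists y : M, y ∈ x /\ forall z : M, z ∈ y -> z ∉ x.

Definition Pairing (M : structure) : Prop :=
  forall a b : M, exists p : M, is_set p /\ is_upair p a b.

Definition Union (M : structure) : Prop :=
  forall x : M, is_set x -> exists y : M, is_set y /\
  forall z : M, z ∈ y <-> exists w : M, w ∈ x /\ z ∈ w.

(** [is_set z] excludes urelements, which vacuously satisfy [sub z x]. *)
Definition Powerset (M : structure) : Prop :=
  forall x : M, is_set x -> exists y : M, is_set y /\
  forall z : M, z ∈ y <-> is_set z /\ sub z x.

Definition Infinity (M : structure) : Prop :=
  exists i : M, is_set i /\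
  (exists e : M, e ∈ i /\ is_set e /\ forall z : M, z ∉ e) /\
  (forall x : M, x ∈ i ->
   exists y : M, y ∈ i /\ forall z : M, z ∈ y <-> z ∈ x \/ z = x).

(** Here and in [Replacement] the formula may have any number of parameters,
    whose values are given by [r]. *)
Definition Separation (M : structure) : Prop :=
  forall (f : formula) (r : nat -> M) (x : M), is_set x ->
  exists y : M, is_set y /\
  forall z : M, z ∈ y <-> z ∈ x /\ sat (scons z r) f.

Definition Replacement (M : structure) : Prop :=
  forall (f : formula) (r : nat -> M) (w : M), is_set w ->
  (forall x : M, x ∈ w -> exists! y : M, sat (scons x (scons y r)) f) ->
  exists v : M, is_set v /\
  forall y : M, y ∈ v <-> exists x : M, x ∈ w /\ sat (scons x (scons y r)) f.

Definition Extensionality (M : structure) : Prop :=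
  forall x y : M, is_set x -> is_set y ->
  (forall z : M, z ∈ x <-> z ∈ y) -> x = y.

Definition Urelements_empty (M : structure) : Prop :=
  forall a x : M, ur a -> x ∉ a.

Record ZFU (M : structure) : Prop := {
  zfu_foundation : Foundation M;
  zfu_pairing : Pairing M;
  zfu_union : Union M;
  zfu_powerset : Powerset M;
  zfu_infinity : Infinity M;
  zfu_separation : Separation M;
  zfu_replacement : Replacement M;
  zfu_extensionality : Extensionality M;
  zfu_urelements : Urelements_empty M
}.

Definition Plenitude_plus (M : structure) : Prop :=
  forall x : M, is_set x ->
  exists A : M, is_set A /\ (forall a : M, a ∈ A -> ur a) /\ equinumerous x A.

Definition cardinality_definable (M : structure) : Prop :=
  exists (f : formula) (p : M),
    vars_below 3 f /\
    (forall x : M, is_set x -> exists! c : M, sat3 f x c p) /\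
    (forall x y : M, is_set x -> is_set y ->
       equinumerous x y <-> exists c : M, sat3 f x c p /\ sat3 f y c p).

Definition Collection (M : structure) : Prop :=
  forall f : formula, vars_below 3 f ->
  forall w u : M,
    (forall x : M, x ∈ w -> exists y : M, sat3 f x y u) ->
    exists v : M, forall x : M, x ∈ w -> exists y : M, y ∈ v /\ sat3 f x y u.

(** The variables 0, ..., n-1 are [x_1, ..., x_n], and [t] is assigned to the
    variable [n], which is not free in [f].  Only the first [n] values of [r]
    are required to lie in [t], so for [n = 0] the formula has to be reflected
    even if [t] is empty. *)
Definition RP (M : structure) : Prop :=
  forall (n : nat) (f : formula), vars_below n f ->
  forall x : M, is_set x ->
  exists t : M, is_set t /\ transitive t /\ sub x t /\
    forall r : nat -> M, r n = t -> (forall i : nat, i < n -> r i ∈ t) ->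
      (sat r f <-> sat r (relativize n f)).

(* Main.v *)
Require Import Defs.
From Stdlib Require Import Classical ClassicalEpsilon Arith Lia List.

Set Implicit Arguments.
Unset Strict Implicit.

(** From reflection to Collection: reflect at once the formula [f(x,y,u)] and the
    formula saying that some [y] satisfies it, two flags that are compared with
    each other telling which of the two is meant.  A transitive set that reflects
    the combination and contains [w] and [u] contains a witness for each [x] in
    [w].

    From Collection to reflection: Collection bounds the witnesses for all tuples
    over a given set, but there is no choice to iterate this along the natural
    numbers, because no canonical bound presents itself when the urelements form
    a proper class.  The iteration is done on the sizes of sets of urelements
    instead of the sets themselves.

    Write [V A y] for the stage, of the rank of [y], of the cumulative hierarchy
    over a set [A] of urelements; every object is in some [V A y].  A permutation
    of a set of urelements extends to a definable automorphism of the universe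
    ([aut_of_swap]), and Plenitude provides disjoint copies of every set of
    urelements, so any [X] disjoint from [A] can be moved to any equinumerous [Y]
    disjoint from [A] by an automorphism that fixes [V A y] pointwise
    ([aut_of_equinumerous]).  Hence whether parameters in [V A y] have a witness
    in some [V (A + X) z] depends on [X] only through its size.

    Sizes are well stratified: let [A0] be a set of urelements over which the
    parameter of the cardinality function is built.  Automorphisms that fix [A0]
    pointwise fix all cardinals, so every cardinal is in some [V A0 j]
    ([card_in_V]).  The stages over [A0], here called levels, are well-ordered, so
    each level [l] has a least successor [next l] such that parameters built over
    a set of urelements of size bounded in [l] have witnesses that need only a set
    of additional urelements of size bounded in [next l].  This is a definable function, and
    Replacement gives a set [Lam] of levels closed under it.

    Finally a single set [E] of urelements is chosen so rich that, whenever [A]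
    and [X] are of size bounded in a member of [Lam], it contains a copy of [X]
    disjoint from [A] ([rich_urset_exists]).  Take the union of the [V A l] for
    [l] in [Lam] and [A] a subset of [E] of size bounded in [l].  For each tuple
    in it that has a witness, moving the additional urelements into [E] gives a
    witness in the union, which therefore reflects the formula by the criterion
    of Tarski and Vaught ([reflects_of_witnesses]). *)

(** * Renaming variables in formulas *)

Definition up (xi : nat -> nat) (i : nat) : nat :=
  match i with O => O | S j => S (xi j) end.

Fixpoint ren (xi : nat -> nat) (f : formula) : formula :=
  match f with
  | fMem i j => fMem (xi i) (xi j)
  | fEq i j => fEq (xi i) (xi j)
  | fUr i => fUr (xi i)
  | fFalse => fFalse
  | fImp g h => fImp (ren xi g) (ren xi h)
  | fAnd g h => fAnd (ren xi g) (ren xi h)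
  | fOr g h => fOr (ren xi g) (ren xi h)
  | fAll g => fAll (ren (up xi) g)
  | fEx g => fEx (ren (up xi) g)
  end.

Lemma sat_agree (M : structure) (f : formula) :
  forall (n : nat) (r s : nat -> M), vars_below n f ->
  (forall i, i < n -> r i = s i) -> sat r f <-> sat s f.
Proof.
  induction f as [i j|i j|i| |f1 IH1 f2 IH2|f1 IH1 f2 IH2|f1 IH1 f2 IH2|f IH|f IH];
    simpl; intros n r s Hv Hrs.
  - rewrite !Hrs by tauto; tauto.
  - rewrite !Hrs by tauto; tauto.
  - rewrite !Hrs by tauto; tauto.
  - tauto.
  - rewrite (IH1 n r s), (IH2 n r s) by tauto; tauto.
  - rewrite (IH1 n r s), (IH2 n r s) by tauto; tauto.
  - rewrite (IH1 n r s), (IH2 n r s) by tauto; tauto.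
  - assert (E : forall a, sat (scons a r) f <-> sat (scons a s) f).
    { intro a; apply (IH (S n)); auto.
      intros [|i] Hi; simpl; auto; apply Hrs; lia. }
    split; intros H a; apply E, H.
  - assert (E : forall a, sat (scons a r) f <-> sat (scons a s) f).
    { intro a; apply (IH (S n)); auto.
      intros [|i] Hi; simpl; auto; apply Hrs; lia. }
    split; intros [a H]; exists a; apply E, H.
Qed.

Lemma vars_below_mono (f : formula) :
  forall m n, vars_below m f -> m <= n -> vars_below n f.
Proof.
  induction f; simpl; intros m n H Hmn; try lia; auto;
    try (destruct H; split; eauto); apply (IHf (S m)); auto; lia.
Qed.

Lemma vars_below_ex (f : formula) : exists n, vars_below n f.
Proof.
  induction f as [i j|i j|i| |f1 IH1 f2 IH2|f1 IH1 f2 IH2|f1 IH1 f2 IH2|f IH|f IH];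
    simpl.
  1-2: exists (S (i + j)); lia.
  1: exists (S i); lia.
  1: now exists 0.
  1-3: destruct IH1 as [n1 H1], IH2 as [n2 H2]; exists (n1 + n2);
    split; eapply vars_below_mono; eauto; lia.
  1-2: destruct IH as [n H]; exists n; apply (vars_below_mono (m := n)); auto.
Qed.

Lemma sat_ext (M : structure) (f : formula) (r s : nat -> M) :
  (forall i, r i = s i) -> sat r f <-> sat s f.
Proof.
  intro H; destruct (vars_below_ex f) as [n Hn].
  now apply (sat_agree (n := n)).
Qed.

Lemma sat_ren (M : structure) (f : formula) :
  forall (xi : nat -> nat) (r : nat -> M),
  sat r (ren xi f) <-> sat (fun i => r (xi i)) f.
Proof.
  induction f as [i j|i j|i| |f1 IH1 f2 IH2|f1 IH1 f2 IH2|f1 IH1 f2 IH2|f IH|f IH];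
    simpl; intros xi r; try tauto.
  - rewrite IH1, IH2; tauto.
  - rewrite IH1, IH2; tauto.
  - rewrite IH1, IH2; tauto.
  - assert (E : forall a, sat (scons a r) (ren (up xi) f) <->
                          sat (scons a (fun i => r (xi i))) f).
    { intro a; rewrite IH; apply sat_ext; now intros [|i]. }
    split; intros H a; apply E, H.
  - assert (E : forall a, sat (scons a r) (ren (up xi) f) <->
                          sat (scons a (fun i => r (xi i))) f).
    { intro a; rewrite IH; apply sat_ext; now intros [|i]. }
    split; intros [a H]; exists a; apply E, H.
Qed.

Lemma vars_below_ren (f : formula) :
  forall m n xi, vars_below m f -> (forall i, i < m -> xi i < n) ->
  vars_below n (ren xi f).
Proof.
  induction f as [i j|i j|i| |f1 IH1 f2 IH2|f1 IH1 f2 IH2|f1 IH1 f2 IH2|f IH|f IH];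
    simpl; intros m n xi H Hxi; auto; try (destruct H; split; now eauto).
  1,2: apply (IH (S m)); auto; intros [|i] Hi; simpl; [lia|];
    apply -> Nat.succ_lt_mono; apply Hxi; lia.
Qed.

(** * Classes and class functions definable with parameters *)

Section Definability.
Context {M : structure}.
Implicit Types (P Q : (nat -> M) -> Prop) (t : (nat -> M) -> M).

Definition val (s : nat -> nat + M) (r : nat -> M) (i : nat) : M :=
  match s i with inl j => r j | inr c => c end.

(** Each variable of the formula stands either for an argument or for a fixed
    object, so that parameters can be gathered from several formulas without
    coding them into one. *)
Definition pdef P : Prop :=
  exists (f : formula) (s : nat -> nat + M), forall r, P r <-> sat (val s r) f.

(** The graph of [t] is definable; entry 0 holds the value. *)
Definition tdef t : Prop := pdef (fun r => r 0 = t (fun i => r (S i))).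

Lemma pdef_iff P Q : pdef P -> (forall r, P r <-> Q r) -> pdef Q.
Proof.
  intros (f & s & H) E; exists f, s; intro r; rewrite <- E; apply H.
Qed.

Lemma pdef_val P (s : nat -> nat + M) : pdef P -> pdef (fun r => P (val s r)).
Proof.
  intros (f & s' & H).
  exists f, (fun i => match s' i with inl j => s j | inr c => inr c end).
  intro r; rewrite H; apply sat_ext; intro i; unfold val.
  now destruct (s' i).
Qed.

Lemma pdef_ren P (xi : nat -> nat) : pdef P -> pdef (fun r => P (fun i => r (xi i))).
Proof. intro H; exact (pdef_val (fun i => inl (xi i)) H). Qed.

Lemma pdef_sat (f : formula) : pdef (fun r => sat r f).
Proof. now exists f, inl. Qed.

Lemma pdef_const (A : Prop) : pdef (fun _ => A).
Proof.
  destruct (classic A) as [H|H].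
  - exists (fImp fFalse fFalse), inl; simpl; tauto.
  - exists fFalse, inl; simpl; tauto.
Qed.

(** Two formulas are put on disjoint sets of variables, the even and the odd
    ones. *)
Lemma pdef_op (c : formula -> formula -> formula) (C : Prop -> Prop -> Prop) :
  (forall r g h, sat (M := M) r (c g h) <-> C (sat r g) (sat r h)) ->
  (forall A A' B B' : Prop, (A <-> A') -> (B <-> B') -> C A B <-> C A' B') ->
  forall P Q, pdef P -> pdef Q -> pdef (fun r => C (P r) (Q r)).
Proof.
  intros Hc HC P Q (f & s & Hf) (g & s' & Hg).
  exists (c (ren (fun i => 2 * i) f) (ren (fun i => S (2 * i)) g)).
  exists (fun i => if Nat.even i then s (Nat.div2 i) else s' (Nat.div2 i)).
  intro r; rewrite Hc; apply HC; rewrite sat_ren.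
  - rewrite Hf; apply sat_ext; intro i; unfold val.
    now rewrite Nat.even_mul, Nat.div2_double.
  - rewrite Hg; apply sat_ext; intro i; unfold val.
    now rewrite Nat.even_succ, Nat.odd_mul, Nat.div2_succ_double.
Qed.

Lemma pdef_imp P Q : pdef P -> pdef Q -> pdef (fun r => P r -> Q r).
Proof. apply (pdef_op (c := fImp) (C := fun A B => A -> B)); simpl; tauto. Qed.

Lemma pdef_and P Q : pdef P -> pdef Q -> pdef (fun r => P r /\ Q r).
Proof. apply (pdef_op (c := fAnd) (C := and)); simpl; tauto. Qed.

Lemma pdef_or P Q : pdef P -> pdef Q -> pdef (fun r => P r \/ Q r).
Proof. apply (pdef_op (c := fOr) (C := or)); simpl; tauto. Qed.

Lemma pdef_not P : pdef P -> pdef (fun r => ~ P r).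
Proof. intro H; exact (pdef_imp H (pdef_const False)). Qed.

Lemma pdef_equiv P Q : pdef P -> pdef Q -> pdef (fun r => P r <-> Q r).
Proof. intros H K; exact (pdef_and (pdef_imp H K) (pdef_imp K H)). Qed.

Lemma pdef_ex (Q : M -> (nat -> M) -> Prop) :
  pdef (fun r => Q (r 0) (fun i => r (S i))) -> pdef (fun r => exists a, Q a r).
Proof.
  intros (f & s & H).
  exists (fEx (ren (fun i => match s i with inl O => O | _ => S i end) f)).
  exists (fun i => match s i with inl j => inl (Nat.pred j) | inr c => inr c end).
  intro r; simpl.
  assert (E : forall a, Q a r <-> sat (scons a (val (fun i => match s i with
      inl j => inl (Nat.pred j) | inr c => inr c end) r))
      (ren (fun i => match s i with inl O => O | _ => S i end) f)).
  { intro a; rewrite sat_ren; change (Q a r) with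
      ((fun r => Q (r 0) (fun i => r (S i))) (scons a r)).
    rewrite H; apply sat_ext; intro i; unfold val.
    destruct (s i) as [[|j]|c] eqn:Es; simpl; now rewrite ?Es. }
  split; intros [a Ha]; exists a; apply E, Ha.
Qed.

Lemma pdef_all (Q : M -> (nat -> M) -> Prop) :
  pdef (fun r => Q (r 0) (fun i => r (S i))) -> pdef (fun r => forall a, Q a r).
Proof.
  intro H; apply pdef_iff with (fun r => ~ exists a, ~ Q a r).
  - apply pdef_not, pdef_ex, pdef_not, H.
  - intro r; split.
    + intros Hn a; apply NNPP; intro Ha; apply Hn; now exists a.
    + intros Ha [a Hn]; apply Hn, Ha.
Qed.

Lemma pdef_subst (Q : M -> (nat -> M) -> Prop) t :
  tdef t -> pdef (fun r => Q (r 0) (fun i => r (S i))) -> pdef (fun r => Q (t r) r).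
Proof.
  intros Ht HQ; apply pdef_iff with (fun r => exists a, a = t r /\ Q a r).
  - apply pdef_ex, pdef_and; assumption.
  - intro r; split; [now intros (a & -> & H)|now exists (t r)].
Qed.

Lemma tdef_tl t : tdef t -> tdef (fun r => t (fun i => r (S i))).
Proof.
  intro H; exact (pdef_ren (fun i => match i with O => O | S j => S (S j) end) H).
Qed.

Lemma pdef_eq01 : pdef (fun r => r 0 = r 1).
Proof. exact (pdef_sat (fEq 0 1)). Qed.

Lemma tdef_var i : tdef (fun r => r i).
Proof. exact (pdef_ren (fun j => match j with O => O | _ => S i end) pdef_eq01). Qed.

Lemma tdef_const c : tdef (fun _ => c).
Proof.
  exact (pdef_val (fun i => match i with O => inl 0 | _ => inr c end) pdef_eq01).
Qed.

Lemma pdef_rel1 (R : M -> Prop) t :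
  pdef (fun r => R (r 0)) -> tdef t -> pdef (fun r => R (t r)).
Proof. intros H Ht; exact (pdef_subst (Q := fun a _ => R a) Ht H). Qed.

Lemma pdef_rel2 (R : M -> M -> Prop) t1 t2 :
  pdef (fun r => R (r 0) (r 1)) -> tdef t1 -> tdef t2 ->
  pdef (fun r => R (t1 r) (t2 r)).
Proof.
  intros H H1 H2; apply (pdef_subst (Q := fun a r => R a (t2 r)) H1).
  apply (pdef_subst (Q := fun b r => R (r 0) b) (tdef_tl H2)).
  exact (pdef_ren (fun i => match i with O => 1 | _ => 0 end) H).
Qed.

Lemma pdef_mem t1 t2 : tdef t1 -> tdef t2 -> pdef (fun r => t1 r ∈ t2 r).
Proof. apply pdef_rel2; exact (pdef_sat (fMem 0 1)). Qed.

Lemma pdef_eq t1 t2 : tdef t1 -> tdef t2 -> pdef (fun r => t1 r = t2 r).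
Proof. apply pdef_rel2, pdef_eq01. Qed.

Lemma pdef_ur t : tdef t -> pdef (fun r => ur (t r)).
Proof. apply pdef_rel1; exact (pdef_sat (fUr 0)). Qed.

Lemma tdef_fun1 (F : M -> M) t :
  tdef (fun r => F (r 0)) -> tdef t -> tdef (fun r => F (t r)).
Proof.
  intros H Ht; apply (pdef_subst (Q := fun a r => r 0 = F a) (tdef_tl Ht)).
  exact (pdef_ren (fun i => match i with O => 1 | _ => 0 end) H).
Qed.

Lemma tdef_fun2 (F : M -> M -> M) t1 t2 :
  tdef (fun r => F (r 0) (r 1)) -> tdef t1 -> tdef t2 ->
  tdef (fun r => F (t1 r) (t2 r)).
Proof.
  intros H H1 H2.
  apply (pdef_subst (Q := fun a r => r 0 = F a (t2 (fun i => r (S i))))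
           (tdef_tl H1)).
  apply (pdef_subst (Q := fun b r => r 1 = F (r 0) b) (tdef_tl (tdef_tl H2))).
  exact (pdef_ren (fun i => match i with O => 2 | S O => 1 | _ => 0 end) H).
Qed.

Lemma tdef_fun3 (F : M -> M -> M -> M) t1 t2 t3 :
  tdef (fun r => F (r 0) (r 1) (r 2)) -> tdef t1 -> tdef t2 -> tdef t3 ->
  tdef (fun r => F (t1 r) (t2 r) (t3 r)).
Proof.
  intros H H1 H2 H3.
  apply (pdef_subst
    (Q := fun a r => r 0 = F a (t2 (fun i => r (S i))) (t3 (fun i => r (S i))))
    (tdef_tl H1)).
  apply (pdef_subst (Q := fun b r => r 1 = F (r 0) b (t3 (fun i => r (S (S i)))))
    (tdef_tl (tdef_tl H2))).
  apply (pdef_subst (Q := fun c r => r 2 = F (r 1) (r 0) c)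
    (tdef_tl (tdef_tl (tdef_tl H3)))).
  exact (pdef_ren (fun i => match i with O => 3 | 1 => 2 | 2 => 1 | _ => 0 end) H).
Qed.

Lemma pdef_instance2 (d : M) (R : M -> M -> Prop) :
  pdef (fun r => R (r 0) (r 1)) ->
  exists (f : formula) (s : nat -> M),
    forall a b, R a b <-> sat (scons a (scons b s)) f.
Proof.
  intros (f & s & H).
  exists (ren (fun i => match s i with inl O => 0 | inl 1 => 1 | _ => S (S i) end) f).
  exists (fun i => match s i with inl _ => d | inr c => c end).
  intros a b; rewrite sat_ren; change (R a b) with
    ((fun r => R (r 0) (r 1)) (scons a (scons b (fun _ => d)))).
  rewrite H; apply sat_ext; intro i; unfold val.
  destruct (s i) as [[|[|j]]|c] eqn:Es; simpl; now rewrite ?Es.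
Qed.

Lemma pdef_instance1 (d : M) (R : M -> Prop) :
  pdef (fun r => R (r 0)) ->
  exists (f : formula) (s : nat -> M), forall a, R a <-> sat (scons a s) f.
Proof.
  intro H; destruct (pdef_instance2 (R := fun a _ => R a) d H) as (f & s & E).
  exists f, (scons d s); intro a; apply E.
Qed.

End Definability.

(** * Elementary set theory *)

(** [dfn] proves definability by following the syntax.  The two hooks cover the
    predicates and the operations introduced later, and are extended along with
    them; what cannot be decided is left as a goal. *)
Ltac dfn_rel := fail.
Ltac dfn_fun := fail.

Ltac dfn :=
  cbv beta;
  lazymatch goal with
  | |- tdef _ =>
      first [ apply tdef_var | apply tdef_const | assumption | dfn_fun; dfn | idtac ]
  | |- pdef _ =>
      first
      [ apply pdef_const
      | lazymatch goal with
        | |- pdef (fun r => _ /\ _) => apply pdef_and; dfn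
        | |- pdef (fun r => _ \/ _) => apply pdef_or; dfn
        | |- pdef (fun r => _ <-> _) => apply pdef_equiv; dfn
        | |- pdef (fun r => ~ _) => apply pdef_not; dfn
        | |- pdef (fun r => is_set _) => apply pdef_not; dfn
        | |- pdef (fun r => ex _) => apply pdef_ex; dfn
        | |- pdef (fun r => unique _ _) => unfold unique; dfn
        | |- pdef (fun r => sub _ _) => unfold sub; dfn
        | |- pdef (fun r => forall _, _) =>
            first [ apply pdef_imp; dfn | apply pdef_all; dfn | dfn_rel; dfn | idtac ]
        | |- pdef (fun r => _ = _) => apply pdef_eq; dfn
        | |- pdef (fun r => _ ∈ _) => apply pdef_mem; dfn
        | |- pdef (fun r => ur _) => apply pdef_ur; dfn
        | |- _ => first [assumption | dfn_rel; dfn | idtac]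
        end ]
  | |- _ => idtac
  end.

Section SetTheory.
Context {M : structure} (zf : ZFU M).
Implicit Types (x y z a A B C D E K X Y : M).

Lemma model_inhabited : inhabited M.
Proof. destruct (zfu_infinity zf) as [i _]; exact (inhabits i). Qed.

Lemma mem_set x y : x ∈ y -> is_set y.
Proof. intros H U; exact (zfu_urelements zf U H). Qed.

Lemma set_ext x y : is_set x -> is_set y -> (forall z, z ∈ x <-> z ∈ y) -> x = y.
Proof. apply (zfu_extensionality zf). Qed.

Lemma no_two_cycle x y : x ∈ y -> y ∈ x -> False.
Proof.
  intros Hxy Hyx.
  destruct (zfu_pairing zf x y) as (p & _ & Hp).
  destruct (zfu_foundation zf (x := p)) as (m & Hm & Hmin).
  { exists x; apply Hp; auto. }
  destruct (proj1 (Hp m) Hm) as [->| ->].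
  - apply (Hmin y Hyx), Hp; auto.
  - apply (Hmin x Hxy), Hp; auto.
Qed.

(** ** Definite descriptions and class terms *)

Definition the (P : M -> Prop) : M := epsilon model_inhabited P.

Lemma the_spec (P : M -> Prop) : (exists x, P x) -> P (the P).
Proof. apply epsilon_spec. Qed.

Lemma tdef_the (P : M -> (nat -> M) -> Prop) :
  pdef (fun r => P (r 0) (fun i => r (S i))) ->
  (forall r, exists! v, P v r) -> tdef (fun r => the (fun v => P v r)).
Proof.
  intros HP HU; apply (pdef_iff HP); intro r.
  set (r' := fun i => r (S i)).
  destruct (HU r') as (v & Hv & Hu).
  assert (E : P (the (fun v => P v r')) r') by (apply the_spec; eauto).
  split; intro H.
  - now rewrite <- (Hu _ E), (Hu _ H).
  - now rewrite H.
Qed.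

Definition small (P : M -> Prop) : Prop :=
  exists s, is_set s /\ forall z, z ∈ s <-> P z.

Definition setof (P : M -> Prop) : M :=
  the (fun s => is_set s /\ forall z, z ∈ s <-> P z).

Lemma setofE (P : M -> Prop) : small P -> forall z, z ∈ setof P <-> P z.
Proof. intro H; exact (proj2 (the_spec H)). Qed.

Lemma set_setof (P : M -> Prop) : small P -> is_set (setof P).
Proof. intro H; exact (proj1 (the_spec H)). Qed.

Lemma tdef_setof (P : M -> (nat -> M) -> Prop) :
  pdef (fun r => P (r 0) (fun i => r (S i))) ->
  (forall r, small (fun z => P z r)) -> tdef (fun r => setof (fun z => P z r)).
Proof.
  intros HP HS; unfold setof.
  apply (tdef_the (P := fun s r => is_set s /\ forall z, z ∈ s <-> P z r)).
  - dfn. exact (pdef_ren (fun i => match i with O => 0 | S j => S (S j) end) HP).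
  - intro r; destruct (HS r) as (s & Hs & H); exists s; split; [now split|].
    intros s' (Hs' & H'); apply set_ext; auto; intro z; now rewrite H, H'.
Qed.

(** A bound that is an urelement is harmless: it has no members, so [P] is empty. *)
Lemma small_separation (P : M -> Prop) y :
  pdef (fun r => P (r 0)) -> (forall z, P z -> z ∈ y) -> small P.
Proof.
  intros HP Hy; destruct (pdef_instance1 y HP) as (f & s & Hf).
  assert (K : exists y', is_set y' /\ forall z, P z -> z ∈ y').
  { destruct (classic (is_set y)) as [Sy|Uy]; [now exists y|].
    destruct (zfu_infinity zf) as (i & Hi & _); exists i; split; auto.
    intros z Hz; destruct Uy; apply (mem_set (Hy z Hz)). }
  destruct K as (y' & Sy & Hy').
  destruct (zfu_separation zf f s Sy) as (t & St & Ht).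
  exists t; split; auto; intro z; rewrite Ht, <- Hf; firstorder.
Qed.

(** Unlike in the schema, [R] may be undefined on part of [w]; that part is first
    separated off. *)
Lemma small_replacement w (R : M -> M -> Prop) :
  pdef (fun r => R (r 0) (r 1)) ->
  (forall x y y', x ∈ w -> R x y -> R x y' -> y = y') ->
  small (fun y => exists x, x ∈ w /\ R x y).
Proof.
  intros HR Hfun; destruct (pdef_instance2 w HR) as (f & s & Hf).
  destruct (small_separation (P := fun x => x ∈ w /\ exists y, R x y) (y := w))
    as (w' & Sw & Hw).
  { dfn. exact (pdef_ren (fun i => match i with O => 1 | _ => 0 end) HR). }
  { tauto. }
  destruct (zfu_replacement zf (f := f) (r := s) Sw) as (v & Sv & Hv).
  { intros x Hx; apply Hw in Hx; destruct Hx as (Hx & y & Hy).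
    exists y; split; [now apply Hf|].
    intros y' Hy'; apply Hf in Hy'; eauto. }
  exists v; split; auto; intro y; rewrite Hv; split.
  - intros (x & Hx & Hy); apply Hw in Hx; apply Hf in Hy; exists x; tauto.
  - intros (x & Hx & Hy); exists x; rewrite Hw, <- Hf; eauto.
Qed.

(** ** Basic operations *)

(** All of these are total, an urelement counting as the empty set, so that they
    can be composed in definable terms without side conditions. *)

Lemma small_upair a b : small (fun z => z = a \/ z = b).
Proof. destruct (zfu_pairing zf a b) as (p & Sp & Hp); now exists p. Qed.

Definition upair a b := setof (fun z => z = a \/ z = b).

Lemma upairE a b z : z ∈ upair a b <-> z = a \/ z = b.
Proof. apply (setofE (small_upair a b)). Qed.

Lemma small_Un x : small (fun z => exists w, w ∈ x /\ z ∈ w).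
Proof.
  destruct (classic (is_set x)) as [Sx|Ux].
  - destruct (zfu_union zf Sx) as (u & Su & Hu); now exists u.
  - apply small_separation with x; [dfn|].
    intros z (w & Hw & _); destruct Ux; apply (mem_set Hw).
Qed.

Definition Un x := setof (fun z => exists w, w ∈ x /\ z ∈ w).

Lemma UnE x z : z ∈ Un x <-> exists w, w ∈ x /\ z ∈ w.
Proof. apply (setofE (small_Un x)). Qed.

Lemma small_un2 x y : small (fun z => z ∈ x \/ z ∈ y).
Proof.
  apply small_separation with (Un (upair x y)); [dfn|].
  intros z [H|H]; apply UnE; [exists x|exists y]; rewrite upairE; auto.
Qed.

Definition un2 x y := setof (fun z => z ∈ x \/ z ∈ y).

Lemma un2E x y z : z ∈ un2 x y <-> z ∈ x \/ z ∈ y.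
Proof. apply (setofE (small_un2 x y)). Qed.

Lemma set_un2 x y : is_set (un2 x y).
Proof. apply (set_setof (small_un2 x y)). Qed.

Lemma small_empty : small (fun _ => False).
Proof. destruct model_inhabited as [y]; apply small_separation with y; [dfn|tauto]. Qed.

Definition empty := setof (fun _ => False).

Lemma emptyE z : ~ z ∈ empty.
Proof. exact (proj1 (setofE small_empty z)). Qed.

Lemma set_empty : is_set empty.
Proof. exact (set_setof small_empty). Qed.

Lemma small_pow x : small (fun z => is_set z /\ sub z x).
Proof.
  destruct (classic (is_set x)) as [Sx|Ux].
  - destruct (zfu_powerset zf Sx) as (u & Su & Hu); now exists u.
  - apply small_separation with (upair empty empty); [dfn|].
    intros z (Sz & Hz); apply upairE; left; apply set_ext; auto using set_empty.
    intro w; split; intro Hw.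
    + destruct Ux; apply (mem_set (Hz _ Hw)).
    + destruct (emptyE Hw).
Qed.

Definition pow x := setof (fun z => is_set z /\ sub z x).

Lemma powE x z : z ∈ pow x <-> is_set z /\ sub z x.
Proof. apply (setofE (small_pow x)). Qed.

Definition sing x := upair x x.

Lemma singE x z : z ∈ sing x <-> z = x.
Proof. unfold sing; rewrite upairE; tauto. Qed.

Definition opair a b := upair (sing a) (upair a b).

Lemma set_upair a b : is_set (upair a b).
Proof. apply (set_setof (small_upair a b)). Qed.

Lemma opair_inj a b c d : opair a b = opair c d -> a = c /\ b = d.
Proof.
  intro E.
  assert (H : forall z, z ∈ opair a b <-> z ∈ opair c d) by now rewrite E.
  unfold opair in H; setoid_rewrite upairE in H.
  assert (K : forall u v, u = v -> forall z, z ∈ u <-> z ∈ v) by now intros u v ->.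
  assert (Eac : a = c).
  { destruct (proj1 (H (sing a)) (or_introl eq_refl)) as [E'|E'];
      symmetry; apply (singE a), (K _ _ E'); [now apply singE|apply upairE; auto]. }
  split; auto; subst c.
  assert (Hb : b = a \/ b = d).
  { destruct (proj1 (H (upair a b)) (or_intror eq_refl)) as [E'|E'].
    - left; apply (singE a), (K _ _ E'), upairE; auto.
    - apply (upairE a d), (K _ _ E'), upairE; auto. }
  assert (Hd : d = a \/ d = b).
  { destruct (proj2 (H (upair a d)) (or_intror eq_refl)) as [E'|E'].
    - left; apply (singE a), (K _ _ E'), upairE; auto.
    - apply (upairE a b), (K _ _ E'), upairE; auto. }
  destruct Hb, Hd; congruence.
Qed.

Lemma is_upairE p a b : is_upair p a b <-> p = upair a b.
Proof.
  split.
  - intro H; apply set_ext; auto using set_upair.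
    + apply (mem_set (x := a)), H; auto.
    + intro z; rewrite upairE; apply H.
  - intros -> z; apply upairE.
Qed.

Lemma is_opairE p a b : is_opair p a b <-> p = opair a b.
Proof.
  unfold is_opair; split.
  - intros (s & d & H1 & H2 & H3); apply is_upairE in H1, H2, H3; now subst.
  - intros ->; exists (sing a), (upair a b); now rewrite !is_upairE.
Qed.

Lemma tdef_upair t1 t2 : tdef t1 -> tdef t2 -> tdef (fun r => upair (t1 r) (t2 r)).
Proof.
  apply tdef_fun2; unfold upair.
  apply (tdef_setof (P := fun z r => z = r 0 \/ z = r 1)); [dfn|].
  intro r; apply small_upair.
Qed.

Lemma tdef_Un t : tdef t -> tdef (fun r => Un (t r)).
Proof.
  apply tdef_fun1; unfold Un.
  apply (tdef_setof (P := fun z r => exists w, w ∈ r 0 /\ z ∈ w)); [dfn|].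
  intro r; apply small_Un.
Qed.

Lemma tdef_un2 t1 t2 : tdef t1 -> tdef t2 -> tdef (fun r => un2 (t1 r) (t2 r)).
Proof.
  apply tdef_fun2; unfold un2.
  apply (tdef_setof (P := fun z r => z ∈ r 0 \/ z ∈ r 1)); [dfn|].
  intro r; apply small_un2.
Qed.

Lemma tdef_pow t : tdef t -> tdef (fun r => pow (t r)).
Proof.
  apply tdef_fun1; unfold pow.
  apply (tdef_setof (P := fun z r => is_set z /\ sub z (r 0))); [dfn|].
  intro r; apply small_pow.
Qed.

Lemma tdef_sing t : tdef t -> tdef (fun r => sing (t r)).
Proof. intro H; unfold sing; now apply tdef_upair. Qed.

Lemma tdef_opair t1 t2 : tdef t1 -> tdef t2 -> tdef (fun r => opair (t1 r) (t2 r)).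
Proof. intros; unfold opair; auto using tdef_upair, tdef_sing. Qed.

Ltac dfn_fun ::=
  first [ apply tdef_opair | apply tdef_upair | apply tdef_sing | apply tdef_un2
        | apply tdef_Un | apply tdef_pow ].

(** ** Iteration along the natural numbers, and induction on membership *)

Definition succ x := un2 x (sing x).

Lemma succE x z : z ∈ succ x <-> z ∈ x \/ z = x.
Proof. unfold succ; now rewrite un2E, singE. Qed.

Lemma succ_inj x y : succ x = succ y -> x = y.
Proof.
  intro E.
  assert (Hx : x ∈ succ y) by (rewrite <- E; apply succE; auto).
  assert (Hy : y ∈ succ x) by (rewrite E; apply succE; auto).
  apply succE in Hx, Hy; destruct Hx as [Hx|Hx], Hy as [Hy|Hy]; auto.
  destruct (no_two_cycle Hx Hy).
Qed.

(** A finite piece of the iteration [n |-> G^n(a)] is a set of pairs each of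
    which is the initial one or comes from another one.  The set given by
    Infinity may contain more than the natural numbers, so only those of its
    members are used at which the value is unique. *)
Lemma closed_set_exists (G : M -> M) (a : M) : tdef (fun r => G (r 0)) ->
  exists L, is_set L /\ a ∈ L /\ forall x, x ∈ L -> G x ∈ L.
Proof.
  intro HG.
  set (piece := fun s => forall p, p ∈ s -> p = opair empty a \/
    exists m y, opair m y ∈ s /\ p = opair (succ m) (G y)).
  set (R := fun n z => exists s, piece s /\ opair n z ∈ s).
  set (R1 := fun n z => R n z /\ forall z', R n z' -> z' = z).
  assert (DR : forall i j, pdef (fun r => R (r i) (r j))).
  { intros i j; unfold R, piece, succ; dfn. }
  destruct (zfu_infinity zf) as (I & SI & (e & He & Se & Hempty) & Hsucc).
  assert (He' : e = empty).
  { apply set_ext; auto using set_empty; intro z; split; intro H.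
    - destruct (Hempty z H). - destruct (emptyE H). }
  subst e.
  assert (HI : forall n, n ∈ I -> succ n ∈ I).
  { intros n Hn; destruct (Hsucc n Hn) as (y & Hy & E).
    replace (succ n) with y; auto; apply set_ext; auto.
    - apply (mem_set (x := n)), E; auto.
    - apply set_un2.
    - intro z; now rewrite E, succE. }
  assert (HS : small (fun z => exists n, n ∈ I /\ R1 n z)).
  { apply small_replacement.
    - unfold R1; dfn; apply DR.
    - intros n z z' _ (H1 & H2) (H3 & H4); auto. }
  exists (setof (fun z => exists n, n ∈ I /\ R1 n z)).
  assert (R0 : forall z, R empty z -> z = a).
  { intros z (s & Hs & Hz); destruct (Hs _ Hz) as [E|(m & y & _ & E)];
      apply opair_inj in E; destruct E as [E1 E2]; auto.
    destruct (@emptyE m); rewrite E1; apply succE; auto. }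
  assert (RS : forall n z, R (succ n) z -> exists y, R n y /\ z = G y).
  { intros n z (s & Hs & Hz); destruct (Hs _ Hz) as [E|(m & y & Hy & E)];
      apply opair_inj in E; destruct E as [E1 E2].
    - destruct (@emptyE n); rewrite <- E1; apply succE; auto.
    - apply succ_inj in E1; subst m; exists y; split; auto; now exists s. }
  split; [now apply set_setof|split].
  - apply (setofE HS); exists empty; split; auto; split; auto.
    exists (sing (opair empty a)); split; [|now apply singE].
    intros p Hp; apply singE in Hp; auto.
  - intros x Hx; apply (setofE HS) in Hx; apply (setofE HS).
    destruct Hx as (n & Hn & Hx & Hu); exists (succ n); split; auto; split.
    + destruct Hx as (s & Hs & Hx).
      exists (un2 s (sing (opair (succ n) (G x)))); split.
      * intros p Hp; apply un2E in Hp; rewrite singE in Hp; destruct Hp as [Hp| ->].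
        -- destruct (Hs p Hp) as [E|(m & y & Hm & E)]; auto.
           right; exists m, y; rewrite un2E; auto.
        -- right; exists n, x; rewrite un2E; auto.
      * rewrite un2E, singE; auto.
    + intros z Hz; destruct (RS n z Hz) as (y & Hy & ->); now rewrite (Hu y Hy).
Qed.

Lemma transitive_superset x : exists t, transitive t /\ sub x t.
Proof.
  destruct (@closed_set_exists Un x) as (L & _ & Ha & HL); [dfn|].
  exists (Un L); split.
  - intros y z Hy Hz; apply UnE in Hy; destruct Hy as (w & Hw & Hy).
    apply UnE; exists (Un w); split; auto; apply UnE; eauto.
  - intros z Hz; apply UnE; eauto.
Qed.

Lemma mem_ind (P : M -> Prop) : pdef (fun r => P (r 0)) ->
  (forall x, (forall z, z ∈ x -> P z) -> P x) -> forall x, P x.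
Proof.
  intros DP HP x; apply NNPP; intro Hx.
  destruct (transitive_superset (sing x)) as (t & Ht & Hxt).
  assert (HS : small (fun z => z ∈ t /\ ~ P z)).
  { apply small_separation with t; [dfn|tauto]. }
  destruct (zfu_foundation zf (x := setof (fun z => z ∈ t /\ ~ P z)))
    as (m & Hm & Hmin).
  { exists x; apply (setofE HS); split; auto; now apply Hxt, singE. }
  apply (setofE HS) in Hm; destruct Hm as (Hm & Hn); apply Hn, HP.
  intros z Hz; apply NNPP; intro H; apply (Hmin z Hz), (setofE HS).
  split; auto; now apply (Ht m).
Qed.


(** * Equinumerosity *)

(** The bijection is kept as a relation, so that new ones can be given by formulas
    and turned into sets only at the end, by [equinumerous_intro]. *)
Definition bij (R : M -> M -> Prop) x y : Prop :=
  (forall a, a ∈ x -> exists b, b ∈ y /\ R a b) /\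
  (forall b, b ∈ y -> exists a, a ∈ x /\ R a b) /\
  (forall a b b', a ∈ x -> b ∈ y -> b' ∈ y -> R a b -> R a b' -> b = b') /\
  (forall a a' b, a ∈ x -> a' ∈ x -> b ∈ y -> R a b -> R a' b -> a = a').

Lemma opair_pow a b u : a ∈ u -> b ∈ u -> opair a b ∈ pow (pow u).
Proof.
  intros Ha Hb; unfold opair, sing; apply powE; split; [apply set_upair|].
  intros z Hz; apply upairE in Hz; apply powE.
  destruct Hz as [->| ->]; (split; [apply set_upair|]);
    intros w Hw; apply upairE in Hw; destruct Hw as [->| ->]; auto.
Qed.

Lemma equinumerous_intro (R : M -> M -> Prop) x y :
  pdef (fun r => R (r 0) (r 1)) -> bij R x y -> equinumerous x y.
Proof.
  intros DR (H1 & H2 & H3 & H4).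
  set (P := fun p => exists a b, a ∈ x /\ b ∈ y /\ R a b /\ p = opair a b).
  assert (HS : small P).
  { apply small_separation with (pow (pow (un2 x y))).
    - unfold P; dfn; apply (pdef_rel2 DR); dfn.
    - intros p (a & b & Ha & Hb & _ & ->); apply opair_pow; apply un2E; auto. }
  assert (HM : forall a b, a ∈ x -> b ∈ y -> maps_to (setof P) a b <-> R a b).
  { intros a b Ha Hb; unfold maps_to; split.
    - intros (p & Hp & E); apply is_opairE in E; apply (setofE HS) in Hp.
      destruct Hp as (a' & b' & _ & _ & HR & E'); rewrite E in E'.
      apply opair_inj in E'; destruct E' as [<- <-]; auto.
    - intro HR; exists (opair a b); rewrite is_opairE; split; auto.
      apply (setofE HS); exists a, b; auto. }
  exists (setof P); split; [now apply set_setof|split; [|split]].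
  - intros p Hp; apply (setofE HS) in Hp; destruct Hp as (a & b & Ha & Hb & _ & ->).
    exists a, b; rewrite is_opairE; auto.
  - intros a Ha; destruct (H1 a Ha) as (b & Hb & HR); exists b; split.
    + split; auto; now apply HM.
    + intros b' (Hb' & HR'); apply HM in HR'; eauto.
  - intros b Hb; destruct (H2 b Hb) as (a & Ha & HR); exists a; split.
    + split; auto; now apply HM.
    + intros a' (Ha' & HR'); apply HM in HR'; eauto.
Qed.

Lemma equinumerous_elim x y : equinumerous x y ->
  exists f, bij (fun a b => opair a b ∈ f) x y.
Proof.
  intros (f & Sf & _ & H2 & H3); exists f.
  assert (E : forall a b, opair a b ∈ f -> maps_to f a b).
  { intros a b H; exists (opair a b); now rewrite is_opairE. }
  assert (E' : forall a b, maps_to f a b -> opair a b ∈ f).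
  { intros a b (p & Hp & E1); apply is_opairE in E1; now subst. }
  split; [|split; [|split]].
  - intros a Ha; destruct (H2 a Ha) as (b & (Hb & Hab) & _); eauto.
  - intros b Hb; destruct (H3 b Hb) as (a & (Ha & Hab) & _); eauto.
  - intros a b b' Ha Hb Hb' K K'; destruct (H2 a Ha) as (c & _ & U).
    rewrite <- (U b), <- (U b'); auto.
  - intros a a' b Ha Ha' Hb K K'; destruct (H3 b Hb) as (c & _ & U).
    rewrite <- (U a), <- (U a'); auto.
Qed.

Lemma equinumerous_refl x : equinumerous x x.
Proof.
  apply equinumerous_intro with (fun a b => a = b); [dfn|].
  repeat split; eauto; congruence.
Qed.

Lemma equinumerous_sym x y : equinumerous x y -> equinumerous y x.
Proof.
  intro H; destruct (equinumerous_elim H) as (f & H1 & H2 & H3 & H4).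
  apply equinumerous_intro with (fun b a => opair a b ∈ f); [dfn|].
  repeat split; eauto.
Qed.

Lemma equinumerous_trans x y z :
  equinumerous x y -> equinumerous y z -> equinumerous x z.
Proof.
  intros H K; destruct (equinumerous_elim H) as (f & H1 & H2 & H3 & H4).
  destruct (equinumerous_elim K) as (g & K1 & K2 & K3 & K4).
  apply equinumerous_intro with
    (fun a c => exists b, b ∈ y /\ opair a b ∈ f /\ opair b c ∈ g); [dfn|].
  split; [|split; [|split]].
  - intros a Ha; destruct (H1 a Ha) as (b & Hb & ?), (K1 b Hb) as (c & Hc & ?); eauto 6.
  - intros c Hc; destruct (K2 c Hc) as (b & Hb & ?), (H2 b Hb) as (a & Ha & ?); eauto 6.
  - intros a c c' Ha Hc Hc' (b & Hb & ? & ?) (b' & Hb' & ? & ?).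
    assert (b = b') by eauto; subst b'; eauto.
  - intros a a' c Ha Ha' Hc (b & Hb & ? & ?) (b' & Hb' & ? & ?).
    assert (b = b') by eauto; subst b'; eauto.
Qed.

Lemma equinumerous_sub x y x' : equinumerous x y -> sub x' x -> 
  exists y', is_set y' /\ sub y' y /\ equinumerous x' y'.
Proof.
  intros H Hx; destruct (equinumerous_elim H) as (f & H1 & H2 & H3 & H4).
  assert (HS : small (fun b => b ∈ y /\ exists a, a ∈ x' /\ opair a b ∈ f)).
  { apply small_separation with y; [dfn|tauto]. }
  exists (setof (fun b => b ∈ y /\ exists a, a ∈ x' /\ opair a b ∈ f)).
  split; [now apply set_setof|split].
  - intros b Hb; now apply (setofE HS) in Hb.
  - apply equinumerous_intro with (fun a b => opair a b ∈ f); [dfn|].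
    split; [|split; [|split]].
    + intros a Ha; destruct (H1 a (Hx a Ha)) as (b & Hb & K).
      exists b; rewrite (setofE HS); eauto.
    + intros b Hb; apply (setofE HS) in Hb; tauto.
    + intros a b b' Ha Hb Hb'; apply (setofE HS) in Hb, Hb'; apply H3; tauto || auto.
    + intros a a' b Ha Ha' Hb; apply (setofE HS) in Hb; apply H4; tauto || auto.
Qed.

Lemma equinumerous_union x y x' y' :
  equinumerous x y -> equinumerous x' y' ->
  (forall z, z ∈ x -> z ∈ x' -> False) -> (forall z, z ∈ y -> z ∈ y' -> False) ->
  equinumerous (un2 x x') (un2 y y').
Proof.
  intros H K Dx Dy; destruct (equinumerous_elim H) as (f & H1 & H2 & H3 & H4).
  destruct (equinumerous_elim K) as (g & K1 & K2 & K3 & K4).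
  apply equinumerous_intro with (fun a b =>
    (a ∈ x /\ b ∈ y /\ opair a b ∈ f) \/ (a ∈ x' /\ b ∈ y' /\ opair a b ∈ g)); [dfn|].
  split; [|split; [|split]].
  - intros a Ha; apply un2E in Ha; destruct Ha as [Ha|Ha].
    + destruct (H1 a Ha) as (b & ? & ?); exists b; rewrite un2E; tauto.
    + destruct (K1 a Ha) as (b & ? & ?); exists b; rewrite un2E; tauto.
  - intros b Hb; apply un2E in Hb; destruct Hb as [Hb|Hb].
    + destruct (H2 b Hb) as (a & ? & ?); exists a; rewrite un2E; tauto.
    + destruct (K2 b Hb) as (a & ? & ?); exists a; rewrite un2E; tauto.
  - intros a b b' _ _ _ [(?&?&?)|(?&?&?)] [(?&?&?)|(?&?&?)]; eauto;
      exfalso; eauto.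
  - intros a a' b _ _ _ [(?&?&?)|(?&?&?)] [(?&?&?)|(?&?&?)]; eauto;
      exfalso; eauto.
Qed.

Lemma pdef_equinumerous (t1 t2 : (nat -> M) -> M) :
  tdef t1 -> tdef t2 -> pdef (fun r => equinumerous (t1 r) (t2 r)).
Proof.
  apply pdef_rel2.
  unfold equinumerous, bijection, maps_to, is_opair, is_upair; dfn.
Qed.

Ltac dfn_rel ::= apply pdef_equinumerous.

(** * Collection with several parameters *)

Definition fUpair (p a b : nat) : formula :=
  let e := fOr (fEq 0 (S a)) (fEq 0 (S b)) in
  fAll (fAnd (fImp (fMem 0 (S p)) e) (fImp e (fMem 0 (S p)))).

Definition fOpair (p a b : nat) : formula :=
  fEx (fEx (fAnd (fUpair 1 (S (S a)) (S (S a)))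
    (fAnd (fUpair 0 (S (S a)) (S (S b))) (fUpair (S (S p)) 1 0)))).

Lemma sat_fOpair (r : nat -> M) (p a b : nat) :
  sat r (fOpair p a b) <-> r p = opair (r a) (r b).
Proof. rewrite <- is_opairE; reflexivity. Qed.

(** Two parameters are merged into one ordered pair, until one is left. *)
Lemma merge_parameters k : forall (f : formula) (s : nat -> M),
  vars_below (3 + k) f -> exists f' u, vars_below 3 f' /\
    forall x y, sat (scons x (scons y s)) f <-> sat3 f' x y u.
Proof.
  induction k as [|k IH]; intros f s Hf.
  - exists f, (s 0); split; auto; intros x y; apply (sat_agree (n := 3)); auto.
    intros [|[|[|i]]] Hi; simpl; auto; lia.
  - set (xi := fun i => match i with 0 => 2 | 1 => 3 | 2 => 1 | 3 => 0 | _ => S i end).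
    set (s' := scons (opair (s 0) (s 1)) (fun i => s (S (S i)))).
    destruct (IH (fEx (fEx (fAnd (fOpair 4 1 0) (ren xi f)))) s')
      as (f' & u & Hf' & E).
    { cbn; repeat split; try lia.
      apply (vars_below_ren Hf); intros [|[|[|[|i]]]] Hi; simpl; lia. }
    exists f', u; split; auto; intros x y; rewrite <- E.
    cbn [sat]; split.
    + intro H; exists (s 0), (s 1); rewrite sat_fOpair, sat_ren; split; auto.
      refine (proj1 (sat_ext f _) H); now intros [|[|[|[|i]]]].
    + intros (a & b & H & K); rewrite sat_fOpair in H; rewrite sat_ren in K.
      cbn in H; apply opair_inj in H; destruct H as [<- <-].
      refine (proj1 (sat_ext f _) K); now intros [|[|[|[|i]]]].
Qed.

Context (coll : Collection M).

Lemma collect (R : M -> M -> Prop) w : pdef (fun r => R (r 0) (r 1)) ->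
  (forall x, x ∈ w -> exists y, R x y) ->
  exists v, forall x, x ∈ w -> exists y, y ∈ v /\ R x y.
Proof.
  intros DR H; destruct (pdef_instance2 w DR) as (f & s & E).
  destruct (vars_below_ex f) as [n Hn].
  destruct (@merge_parameters n f s) as (f' & u & Hf' & E').
  { apply (vars_below_mono Hn); lia. }
  destruct (coll (f := f') Hf' (w := w) (u := u)) as (v & Hv).
  - intros x Hx; destruct (H x Hx) as (y & Hy); exists y; now apply E', E.
  - exists v; intros x Hx; destruct (Hv x Hx) as (y & Hy & Hxy).
    exists y; split; auto; now apply E, E'.
Qed.

(** * Recursion on membership *)

Section Recursion.
Context (H : M -> M -> M -> M) (DH : tdef (fun r => H (r 0) (r 1) (r 2))).

(** [H a y s] is the value at [y], when [s] is the set of the values at the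
    members of [y].  Approximations to the function are sets of pairs whose domain
    contains the members of its elements. *)
Definition values g y := setof (fun w => exists z, z ∈ y /\ opair z w ∈ g).

Lemma small_values g y : small (fun w => exists z, z ∈ y /\ opair z w ∈ g).
Proof.
  apply small_separation with (Un (Un g)); [dfn|].
  intros w (z & _ & Hz); apply UnE; exists (upair z w); rewrite upairE; split; auto.
  apply UnE; exists (opair z w); split; auto; apply upairE; auto.
Qed.

Lemma tdef_values t1 t2 : tdef t1 -> tdef t2 -> tdef (fun r => values (t1 r) (t2 r)).
Proof.
  apply tdef_fun2; unfold values.
  apply (tdef_setof (P := fun w r => exists z, z ∈ r 1 /\ opair z w ∈ r 0)); [dfn|].
  intro r; apply small_values.
Qed.

Definition attempt a g : Prop := forall p, p ∈ g -> exists y,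
  p = opair y (H a y (values g y)) /\ forall z, z ∈ y -> exists w, opair z w ∈ g.

Definition attains a y v : Prop := exists g, attempt a g /\ opair y v ∈ g.

Lemma attemptE a g y v : attempt a g -> opair y v ∈ g ->
  v = H a y (values g y) /\ forall z, z ∈ y -> exists w, opair z w ∈ g.
Proof.
  intros Hg Hy; destruct (Hg _ Hy) as (y' & E & K).
  apply opair_inj in E; destruct E as [<- E]; auto.
Qed.

Lemma pdef_attempt t1 t2 : tdef t1 -> tdef t2 -> pdef (fun r => attempt (t1 r) (t2 r)).
Proof.
  apply pdef_rel2; unfold attempt; dfn.
  apply (tdef_fun3 DH); dfn; apply tdef_values; dfn.
Qed.

Lemma set_values g y : is_set (values g y).
Proof. apply (set_setof (small_values g y)). Qed.

Lemma valuesE g y w : w ∈ values g y <-> exists z, z ∈ y /\ opair z w ∈ g.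
Proof. apply (setofE (small_values g y)). Qed.

Lemma attains_unique a : forall y v v', attains a y v -> attains a y v' -> v = v'.
Proof.
  apply (mem_ind (P := fun y => forall v v', attains a y v -> attains a y v' -> v = v')).
  { unfold attains; dfn; apply pdef_attempt; dfn. }
  intros y IH v v' (g & Hg & Hv) (g' & Hg' & Hv').
  destruct (attemptE Hg Hv) as [-> K], (attemptE Hg' Hv') as [-> K'].
  f_equal; apply set_ext; auto using set_values; intro w; rewrite !valuesE.
  split; intros (z & Hz & Hw); exists z; split; auto.
  - destruct (K' z Hz) as (w' & Hw').
    rewrite (IH z Hz w w'); auto; [now exists g|now exists g'].
  - destruct (K z Hz) as (w' & Hw').
    rewrite (IH z Hz w w'); auto; [now exists g'|now exists g].
Qed.

(** Approximations that attain values at the members of [y] need not be unique, so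
    Collection is used to gather enough of them; their union is an approximation
    since they agree, and is extended by one pair if [y] is not yet in its
    domain. *)
Lemma attains_ex a : forall y, exists v, attains a y v.
Proof.
  apply (mem_ind (P := fun y => exists v, attains a y v)).
  { unfold attains; dfn; apply pdef_attempt; dfn. }
  intros y IH.
  destruct (@collect (fun z g => attempt a g /\ exists v, opair z v ∈ g) y)
    as (c & Hc).
  { dfn; apply pdef_attempt; dfn. }
  { intros z Hz; destruct (IH z Hz) as (v & g & Hg & Hv); eauto. }
  assert (HS : small (fun p => exists g, g ∈ c /\ attempt a g /\ p ∈ g)).
  { apply small_separation with (Un c).
    - dfn; apply pdef_attempt; dfn.
    - intros p (g & ? & _ & ?); apply UnE; eauto. }
  set (g0 := setof (fun p => exists g, g ∈ c /\ attempt a g /\ p ∈ g)).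
  assert (A0 : attempt a g0).
  { intros p Hp; apply (setofE HS) in Hp; destruct Hp as (g & Hgc & Hg & Hp).
    destruct (Hg p Hp) as (y' & -> & K); exists y'; split.
    - do 2 f_equal; apply set_ext; auto using set_values; intro w; rewrite !valuesE.
      split; intros (z & Hz & Hw); exists z; split; auto.
      + apply (setofE HS); eauto.
      + apply (setofE HS) in Hw; destruct Hw as (g' & _ & Hg' & Hw).
        destruct (K z Hz) as (w' & Hw').
        rewrite (@attains_unique a z w w'); auto; [now exists g'|now exists g].
    - intros z Hz; destruct (K z Hz) as (w & Hw); exists w; apply (setofE HS); eauto. }
  assert (D0 : forall z, z ∈ y -> exists w, opair z w ∈ g0).
  { intros z Hz; destruct (Hc z Hz) as (g & Hgc & Hg & v & Hv).
    exists v; apply (setofE HS); eauto. }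
  clearbody g0; clear HS Hc c.
  destruct (classic (exists v, opair y v ∈ g0)) as [(v & Hv)|Hn].
  { exists v, g0; auto. }
  set (g1 := un2 g0 (sing (opair y (H a y (values g0 y))))).
  assert (E1 : forall y', ~ y ∈ y' -> values g1 y' = values g0 y').
  { intros y' Hy'; apply set_ext; auto using set_values; intro w; rewrite !valuesE.
    split; intros (z & Hz & Hw); exists z; split; auto.
    - apply un2E in Hw; rewrite singE in Hw; destruct Hw as [Hw|Hw]; auto.
      apply opair_inj in Hw; destruct Hw; subst; contradiction.
    - apply un2E; auto. }
  exists (H a y (values g0 y)), g1; split.
  - intros p Hp; apply un2E in Hp; rewrite singE in Hp; destruct Hp as [Hp| ->].
    + destruct (A0 p Hp) as (y' & -> & K); exists y'; split.
      * rewrite E1; auto; intro Hy; now apply Hn, K.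
      * intros z Hz; destruct (K z Hz) as (w & Hw); exists w; apply un2E; auto.
    + exists y; split.
      * rewrite E1; auto; intro Hy; apply (no_two_cycle Hy Hy).
      * intros z Hz; destruct (D0 z Hz) as (w & Hw); exists w; apply un2E; auto.
  - apply un2E; rewrite singE; auto.
Qed.

Definition memrec a y := the (fun v => attains a y v).

Lemma attainsE a y v : attains a y v <-> v = memrec a y.
Proof.
  assert (K : attains a y (memrec a y)) by apply (the_spec (attains_ex a y)).
  split; [|now intros ->]; intro Hv; exact (attains_unique Hv K).
Qed.

Lemma memrec_eq a y :
  exists s, is_set s /\ (forall w, w ∈ s <-> exists z, z ∈ y /\ w = memrec a z) /\
  memrec a y = H a y s.
Proof.
  destruct (proj2 (attainsE a y (memrec a y)) eq_refl) as (g & Hg & Hy).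
  destruct (attemptE Hg Hy) as [E K].
  exists (values g y); split; [apply set_values|split; auto].
  intro w; rewrite valuesE; split; intros (z & Hz & Hw); exists z; split; auto.
  - apply attainsE; now exists g.
  - destruct (K z Hz) as (w' & Hw').
    replace w with w'; auto; rewrite Hw; apply attainsE; now exists g.
Qed.

Lemma tdef_memrec t1 t2 : tdef t1 -> tdef t2 -> tdef (fun r => memrec (t1 r) (t2 r)).
Proof.
  apply tdef_fun2; unfold memrec.
  apply (tdef_the (P := fun v r => attains (r 0) (r 1) v)).
  - unfold attains; dfn; apply pdef_attempt; dfn.
  - intro r; exists (memrec (r 0) (r 1)); split; [now apply attainsE|].
    intros v Hv; apply attainsE in Hv; auto.
Qed.

End Recursion.

(** * The cumulative hierarchies over sets of urelements *)

Lemma small_stage A s :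
  small (fun x => x ∈ A \/ exists w, w ∈ s /\ is_set x /\ sub x w).
Proof.
  apply small_separation with (un2 A (pow (Un s))); [dfn|].
  intros x [Hx|(w & Hw & Sx & Hx)]; apply un2E; auto.
  right; apply powE; split; auto; intros z Hz; apply UnE; eauto.
Qed.

(** [V A y] consists of [A] and of the subsets of the [V A z] for [z] in [y].  It
    depends on [y] only through its rank, so that arbitrary objects can serve as
    indices instead of ordinals. *)
Definition stage A (_ : M) s :=
  setof (fun x => x ∈ A \/ exists w, w ∈ s /\ is_set x /\ sub x w).

Lemma tdef_stage : tdef (fun r : nat -> M => stage (r 0) (r 1) (r 2)).
Proof.
  apply (tdef_setof
    (P := fun x r => x ∈ r 0 \/ exists w, w ∈ r 2 /\ is_set x /\ sub x w)); [dfn|].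
  intro r; apply small_stage.
Qed.

Definition V : M -> M -> M := memrec stage.

Lemma tdef_V t1 t2 : tdef t1 -> tdef t2 -> tdef (fun r => V (t1 r) (t2 r)).
Proof. apply (tdef_memrec tdef_stage). Qed.

Ltac dfn_fun ::=
  first [ apply tdef_opair | apply tdef_upair | apply tdef_sing | apply tdef_un2
        | apply tdef_Un | apply tdef_pow | apply tdef_V
        | match goal with H : tdef _ |- _ => apply (tdef_fun1 H) end ].

Lemma VE A y x :
  x ∈ V A y <-> x ∈ A \/ (is_set x /\ exists z, z ∈ y /\ sub x (V A z)).
Proof.
  destruct (memrec_eq tdef_stage A y) as (s & _ & Hs & E).
  unfold V at 1; rewrite E; unfold stage; rewrite (setofE (small_stage A s)).
  split; (intros [H|H]; [now left|right]).
  - destruct H as (w & Hw & Sx & H); split; auto.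
    apply Hs in Hw; destruct Hw as (z & Hz & ->); now exists z.
  - destruct H as (Sx & z & Hz & H); exists (V A z); split; auto.
    apply Hs; now exists z.
Qed.

Lemma set_V A y : is_set (V A y).
Proof.
  destruct (memrec_eq tdef_stage A y) as (s & _ & _ & E).
  unfold V; rewrite E; exact (set_setof (small_stage A s)).
Qed.

Lemma V_set A y z x : is_set x -> z ∈ y -> sub x (V A z) -> x ∈ V A y.
Proof. intros; apply VE; eauto. Qed.

Lemma V_mono A B y y' : sub A B -> sub y y' -> sub (V A y) (V B y').
Proof.
  intros HAB Hy.
  assert (H : forall y, sub (V A y) (V B y)).
  { apply (mem_ind (P := fun y => sub (V A y) (V B y))); [dfn|].
    intros u IH x Hx; apply VE in Hx; destruct Hx as [Hx|(Sx & z & Hz & Hx)].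
    - apply VE; left; now apply HAB.
    - apply (V_set Sx Hz); intros w Hw; now apply (IH z Hz), Hx. }
  intros x Hx; apply H, VE in Hx; apply VE; destruct Hx as [Hx|(Sx & z & Hz & Hx)]; eauto.
  right; split; eauto.
Qed.

Lemma V_mem A : forall y z, z ∈ y -> sub (V A z) (V A y).
Proof.
  apply (mem_ind (P := fun y => forall z, z ∈ y -> sub (V A z) (V A y))); [dfn|].
  intros y IH z Hz x Hx; apply VE in Hx; destruct Hx as [Hx|(Sx & z' & Hz' & Hx)].
  - apply VE; auto.
  - apply (V_set Sx Hz); intros w Hw; now apply (IH z Hz z' Hz'), Hx.
Qed.

Definition urset A : Prop := is_set A /\ forall a, a ∈ A -> ur a.

Lemma V_transitive A y : urset A -> transitive (V A y).
Proof.
  intros (_ & HA) x w Hx Hw; apply VE in Hx; destruct Hx as [Hx|(Sx & z & Hz & Hx)].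
  - destruct (mem_set Hw (HA x Hx)).
  - apply (V_mem Hz); auto.
Qed.

(** For a set [x] the sets of urelements and then the indices belonging to its
    members are collected and merged. *)
Lemma V_cover : forall x, exists A y, urset A /\ x ∈ V A y.
Proof.
  apply (mem_ind (P := fun x => exists A y, urset A /\ x ∈ V A y)).
  { unfold urset; dfn. }
  intros x IH; destruct (classic (ur x)) as [Ux|Sx].
  { exists (sing x), empty; split; [split; [apply set_upair|]|].
    - intros a Ha; apply singE in Ha; now subst.
    - apply VE; left; now apply singE. }
  destruct (@collect (fun z A => urset A /\ exists y, z ∈ V A y) x) as (c & Hc).
  { unfold urset; dfn. }
  { intros z Hz; destruct (IH z Hz) as (A & y & HA & H); eauto. }
  assert (HS : small (fun a => exists A, A ∈ c /\ urset A /\ a ∈ A)).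
  { apply small_separation with (Un c); [unfold urset; dfn|].
    intros a (A & ? & _ & ?); apply UnE; eauto. }
  set (A0 := setof (fun a => exists A, A ∈ c /\ urset A /\ a ∈ A)).
  destruct (@collect (fun z y => z ∈ V A0 y) x) as (d & Hd); [dfn| |].
  { intros z Hz; destruct (Hc z Hz) as (A & HAc & HA & y & H); exists y.
    revert H; apply V_mono; [|now intros ?].
    intros a Ha; apply (setofE HS); eauto. }
  exists A0, (sing (Un (sing d))); split; [split; [now apply set_setof|]|].
  - intros a Ha; apply (setofE HS) in Ha; destruct Ha as (A & _ & (_ & HA) & H); auto.
  - apply (V_set (z := Un (sing d)) Sx); [now apply singE|].
    intros z Hz; destruct (Hd z Hz) as (y & Hy & H).
    apply (@V_mem A0 (Un (sing d)) y); auto.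
    apply UnE; exists d; split; auto; now apply singE.
Qed.

(** By induction on [y]: if some subset [x] of [V A y'] with [y'] in [y] is missing
    from [V A z], then [V A y'] is not included in any [V A z'] with [z'] in [z],
    so each such [V A z'] is included in an earlier stage than [V A y'], and
    [V A z] is included in [V A y']. *)
Lemma V_compare A : forall y z, sub (V A y) (V A z) \/
  exists y', y' ∈ y /\ sub (V A z) (V A y').
Proof.
  apply (mem_ind (P := fun y => forall z, sub (V A y) (V A z) \/
    exists y', y' ∈ y /\ sub (V A z) (V A y'))); [dfn|].
  intros y IH z.
  destruct (classic (exists y' x, y' ∈ y /\ is_set x /\ sub x (V A y') /\ ~ x ∈ V A z))
    as [(y' & x & Hy' & Sx & Hx & Hn)|Hn].
  - right; exists y'; split; auto; intros w Hw; apply VE in Hw.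
    destruct Hw as [Hw|(Sw & z' & Hz' & Hw)]; [apply VE; auto|].
    destruct (IH y' Hy' z') as [H|(y2 & Hy2 & H)].
    + destruct Hn; apply (V_set Sx Hz'); intros u Hu; auto.
    + apply (V_set Sw Hy2); intros u Hu; auto.
  - left; intros x Hx; apply VE in Hx; destruct Hx as [Hx|(Sx & y' & Hy' & Hx)].
    + apply VE; auto.
    + apply NNPP; intro K; apply Hn; exists y', x; auto.
Qed.

(** [V B j] has at least the rank of [j]; thus any index can be replaced by a stage
    over another set of urelements. *)
Lemma V_index A B : forall j, sub (V A j) (V A (V B j)).
Proof.
  apply (mem_ind (P := fun j => sub (V A j) (V A (V B j)))); [dfn|].
  intros j IH x Hx; apply VE in Hx; destruct Hx as [Hx|(Sx & z & Hz & Hx)].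
  - apply VE; auto.
  - apply (V_set (z := V B z) Sx).
    + apply (V_set (@set_V B z) Hz); now intros ?.
    + intros w Hw; apply (IH z Hz), Hx, Hw.
Qed.

(** Membership in a stage means a bound on the rank together with a bound on the
    urelements involved, and the latter bounds can be intersected. *)
Lemma V_inter A B C : urset A -> urset B ->
  (forall a, a ∈ A -> a ∈ B -> a ∈ C) ->
  forall y x z, x ∈ V A y -> x ∈ V B z -> x ∈ V C y.
Proof.
  intros (_ & HA) (_ & HB) HC.
  apply (mem_ind (P := fun y => forall x z, x ∈ V A y -> x ∈ V B z -> x ∈ V C y)); [dfn|].
  intros y IH x z Hx Hx'; apply VE in Hx, Hx'; apply VE.
  destruct Hx as [Hx|(Sx & y' & Hy & Hx)], Hx' as [Hx'|(Sx' & z' & Hz & Hx')]; auto.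
  - destruct Sx'; auto.
  - destruct Sx; auto.
  - right; split; auto; exists y'; split; auto.
    intros w Hw; apply (IH y' Hy w z'); auto.
Qed.

(** * Automorphisms *)

(** The inverse is made part of the notion since the formulas and the hierarchy
    have to be transported in both directions; definability is required so that
    statements about automorphisms can be proved by induction on membership. *)
Record aut (f g : M -> M) : Prop := {
  aut_tdef : tdef (fun r => f (r 0));
  aut_tdef' : tdef (fun r => g (r 0));
  aut_cancel : forall x, g (f x) = x;
  aut_cancel' : forall x, f (g x) = x;
  aut_mem : forall x y, x ∈ y -> f x ∈ f y;
  aut_mem' : forall x y, x ∈ y -> g x ∈ g y;
  aut_ur : forall x, ur x -> ur (f x);
  aut_ur' : forall x, ur x -> ur (g x)
}.

Lemma aut_sym f g : aut f g -> aut g f.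
Proof. intros []; now split. Qed.

Lemma aut_comp f g f' g' : aut f g -> aut f' g' ->
  aut (fun x => f' (f x)) (fun x => g (g' x)).
Proof.
  intros [D1 D1' C1 C1' M1 M1' U1 U1'] [D2 D2' C2 C2' M2 M2' U2 U2']; split; auto;
    intros; rewrite ?C1, ?C2, ?C1', ?C2'; auto.
  - apply (tdef_fun1 D2); apply (tdef_fun1 D1); dfn.
  - apply (tdef_fun1 D1'); apply (tdef_fun1 D2'); dfn.
Qed.

Lemma aut_memE f g x y : aut f g -> x ∈ f y <-> g x ∈ y.
Proof.
  intro F; split; intro H.
  - rewrite <- (aut_cancel F y); now apply (aut_mem' F).
  - rewrite <- (aut_cancel' F x); now apply (aut_mem F).
Qed.

Lemma aut_set f g x : aut f g -> is_set x -> is_set (f x).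
Proof. intros F Sx U; apply Sx; rewrite <- (aut_cancel F x); now apply (aut_ur' F). Qed.

Lemma aut_sat f g (phi : formula) : aut f g -> forall r : nat -> M,
  sat r phi <-> sat (fun i => f (r i)) phi.
Proof.
  intro F.
  induction phi as [i j|i j|i| |p IHp q IHq|p IHp q IHq|p IHp q IHq|p IH|p IH];
    intro r; simpl.
  - rewrite (aut_memE _ _ F), (aut_cancel F); tauto.
  - split; intro H; [now rewrite H|].
    now rewrite <- (aut_cancel F (r i)), H, (aut_cancel F).
  - split; [apply (aut_ur F)|]; intro H.
    rewrite <- (aut_cancel F (r i)); now apply (aut_ur' F).
  - tauto.
  - rewrite IHp, IHq; tauto.
  - rewrite IHp, IHq; tauto.
  - rewrite IHp, IHq; tauto.
  - assert (E : forall a, sat (scons a r) p <-> sat (scons (f a) (fun i => f (r i))) p).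
    { intro a; rewrite IH; apply sat_ext; now intros [|i]. }
    split; intros H a; [rewrite <- (aut_cancel' F a)|]; apply E, H.
  - assert (E : forall a, sat (scons a r) p <-> sat (scons (f a) (fun i => f (r i))) p).
    { intro a; rewrite IH; apply sat_ext; now intros [|i]. }
    split; intros [a H]; [exists (f a); now apply E|].
    exists (g a); apply E; now rewrite (aut_cancel' F).
Qed.

Lemma aut_V f g A : aut f g -> forall y x, x ∈ V A y -> f x ∈ V (f A) y.
Proof.
  intro F; pose proof (aut_tdef F) as D.
  apply (mem_ind (P := fun y => forall x, x ∈ V A y -> f x ∈ V (f A) y)); [dfn|].
  intros y IH x Hx; apply VE in Hx; destruct Hx as [Hx|(Sx & z & Hz & Hx)].
  - apply VE; left; now apply (aut_mem F).
  - apply (V_set (aut_set F Sx) Hz); intros w Hw; apply (aut_memE _ _ F) in Hw.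
    rewrite <- (aut_cancel' F w); now apply IH, Hx.
Qed.

Lemma aut_fix_V f g A : aut f g -> (forall a, a ∈ A -> f a = a) ->
  forall y x, x ∈ V A y -> f x = x.
Proof.
  intros F HA; pose proof (aut_tdef F) as D.
  apply (mem_ind (P := fun y => forall x, x ∈ V A y -> f x = x)); [dfn|].
  intros y IH x Hx; apply VE in Hx; destruct Hx as [Hx|(Sx & z & Hz & Hx)]; auto.
  apply set_ext; auto; [now apply (aut_set F)|].
  intro w; rewrite (aut_memE _ _ F); split; intro Hw.
  - now rewrite <- (aut_cancel' F w), (IH z Hz (g w) (Hx _ Hw)).
  - assert (E : f w = w) by (apply (IH z Hz), Hx, Hw).
    rewrite <- E; now rewrite (aut_cancel F).
Qed.

Lemma aut_equinumerous f g x : aut f g -> equinumerous x (f x).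
Proof.
  intro F; pose proof (aut_tdef F) as D.
  apply equinumerous_intro with (fun a b => b = f a); [dfn|].
  split; [|split; [|split]].
  - intros a Ha; exists (f a); split; auto; now apply (aut_mem F).
  - intros b Hb; exists (g b); rewrite (aut_cancel' F); split; auto.
    now apply (aut_memE _ _ F).
  - intros; now subst.
  - intros a a' b _ _ _ -> E; now rewrite <- (aut_cancel F a), E, (aut_cancel F).
Qed.

Lemma aut_urset f g A : aut f g -> urset A -> urset (f A).
Proof.
  intros F (SA & HA); split; [now apply (aut_set F)|].
  intros a Ha; rewrite <- (aut_cancel' F a); apply (aut_ur F), HA.
  now apply (aut_memE _ _ F).
Qed.

(** Exchanging [X] and [Y] is an involution of the urelements.  It is extended to
    sets by recursion on membership, and the extension is again an involution,
    which makes it bijective. *)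
Lemma aut_of_swap X Y : urset X -> urset Y -> (forall a, a ∈ X -> a ∈ Y -> False) ->
  equinumerous X Y -> exists f, aut f f /\ f X = Y /\
    forall a, ur a -> ~ a ∈ X -> ~ a ∈ Y -> f a = a.
Proof.
  intros (SX & UX) (SY & UY) Dis E.
  destruct (equinumerous_elim E) as (h & H1 & H2 & H3 & H4).
  set (sw := fun u v => (u ∈ X /\ v ∈ Y /\ opair u v ∈ h) \/
                        (v ∈ X /\ u ∈ Y /\ opair v u ∈ h)).
  assert (sw_sym : forall u v, sw u v -> sw v u) by (unfold sw; tauto).
  assert (sw_fun : forall u v v', sw u v -> sw u v' -> v = v').
  { intros u v v' [(?&?&?)|(?&?&?)] [(?&?&?)|(?&?&?)]; eauto; exfalso; eauto. }
  assert (sw_ur : forall u v, sw u v -> ur v).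
  { intros u v [(?&?&?)|(?&?&?)]; auto. }
  (* The image of [y], when [s] is the set of the images of its members. *)
  set (R := fun y s v => (ur y /\ sw y v) \/
    (ur y /\ v = y /\ ~ exists w, sw y w) \/ (is_set y /\ v = s)).
  assert (RU : forall y s, exists! v, R y s v).
  { intros y s; destruct (classic (ur y)) as [U|S].
    - destruct (classic (exists v, sw y v)) as [(v & Hv)|Hn].
      + exists v; split; [left; auto|].
        intros v' [(_ & H)|[(_ & _ & H)|(H & _)]]; [eauto| |contradiction].
        destruct H; eauto.
      + exists y; split; [right; left; auto|].
        intros v' [(_ & H)|[(_ & H & _)|(H & _)]]; auto; [|contradiction].
        destruct Hn; eauto.
    - exists s; split; [right; right; auto|].
      intros v' [(H & _)|[(H & _ & _)|(_ & H)]]; auto; contradiction. }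
  set (step := fun (_ : M) y s => the (fun v => R y s v)).
  assert (DH : tdef (fun r : nat -> M => step (r 0) (r 1) (r 2))).
  { apply (tdef_the (P := fun v r => R (r 1) (r 2) v)); [unfold R, sw; dfn|auto]. }
  set (f := memrec step empty).
  assert (Df : tdef (fun r => f (r 0))).
  { apply (tdef_memrec DH (t1 := fun _ => empty) (t2 := fun r => r 0)); dfn. }
  assert (Hf : forall y, exists s, is_set s /\
    (forall w, w ∈ s <-> exists z, z ∈ y /\ w = f z) /\ R y s (f y)).
  { intro y; destruct (memrec_eq DH empty y) as (s & Ss & Hs & Es).
    exists s; split; auto; split; auto.
    unfold f; rewrite Es; unfold step; apply (the_spec (P := fun v => R y s v)).
    destruct (RU y s) as (v & Hv & _); eauto. }
  assert (fset : forall y, is_set y -> is_set (f y) /\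
    forall w, w ∈ f y <-> exists z, z ∈ y /\ w = f z).
  { intros y Sy; destruct (Hf y) as (s & Ss & Hs & [(U & _)|[(U & _)|(_ & ->)]]);
      auto; contradiction. }
  assert (fsw : forall u v, sw u v -> f u = v).
  { intros u v H; destruct (Hf u) as (s & _ & _ & [(_ & K)|[(_ & _ & K)|(K & _)]]).
    - eauto.
    - destruct K; eauto.
    - destruct K; eauto. }
  assert (fid : forall u, ur u -> ~ (exists v, sw u v) -> f u = u).
  { intros u U H; destruct (Hf u) as (s & _ & _ & [(_ & K)|[(_ & K & _)|(K & _)]]);
      auto; exfalso; eauto. }
  assert (fur : forall u, ur u -> ur (f u)).
  { intros u U; destruct (classic (exists v, sw u v)) as [(v & Hv)|Hn].
    - rewrite (fsw u v Hv); eauto. - now rewrite fid. }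
  clear Hf DH; clearbody f; clear step.
  assert (ff : forall x, f (f x) = x).
  { apply (mem_ind (P := fun x => f (f x) = x)); [dfn|].
    intros x IH; destruct (classic (ur x)) as [U|S].
    - destruct (classic (exists v, sw x v)) as [(v & Hv)|Hn].
      + rewrite (fsw x v Hv); auto.
      + now rewrite !(fid x).
    - destruct (fset x S) as (S' & E1), (fset (f x) S') as (S2 & E2).
      apply set_ext; auto; intro w; rewrite E2; split.
      + intros (z & Hz & ->); apply E1 in Hz; destruct Hz as (z' & Hz' & ->).
        now rewrite IH.
      + intro Hw; exists (f w); rewrite (IH w Hw); split; auto; apply E1; eauto. }
  assert (fmem : forall x y, x ∈ y -> f x ∈ f y).
  { intros x y H; apply (fset y (mem_set H)); eauto. }
  assert (F : aut f f) by (split; auto).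
  exists f; split; auto; split.
  - apply set_ext; auto; [now apply (aut_set F)|].
    intro w; rewrite (aut_memE _ _ F); split; intro H.
    + destruct (H1 _ H) as (b & Hb & K).
      replace w with b; auto; rewrite <- (ff w); symmetry; apply fsw; left; auto.
    + destruct (H2 _ H) as (a & Ha & K).
      replace (f w) with a; auto; symmetry; apply fsw; right; auto.
  - intros a U HX HY; apply fid; auto; intros (v & [(?&?&?)|(?&?&?)]); contradiction.
Qed.

(** * Room among the urelements *)

Context (plen : Plenitude_plus M).

Lemma urset_sub A B : urset A -> is_set B -> sub B A -> urset B.
Proof. intros (_ & HA) SB H; split; auto. Qed.

(** [E] is a copy of the product of [pow U] and [U], which splits into columns
    indexed by [pow U].  Were [A] to meet each column, then a part of [A], and so
    a part of [U], would be mapped onto [pow U].  A column that misses [A]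
    contains a copy of each subset of [U]. *)
Lemma rich_urset_exists U : exists E, urset E /\
  forall A Z, equinumerous A Z -> sub Z U -> forall X, sub X U ->
  exists Y, urset Y /\ sub Y E /\ (forall a, a ∈ Y -> ~ a ∈ A) /\ equinumerous X Y.
Proof.
  assert (HW : small (fun w => exists i u, i ∈ pow U /\ u ∈ U /\ w = opair i u)).
  { apply small_separation with (pow (pow (un2 (pow U) U))); [dfn|].
    intros w (i & u & Hi & Hu & ->); apply opair_pow; apply un2E; auto. }
  destruct (plen (set_setof HW)) as (E & SE & UE & Ek).
  destruct (equinumerous_elim Ek) as (k & K1 & K2 & K3 & K4).
  assert (HWE : forall i u, i ∈ pow U -> u ∈ U -> opair i u ∈
    setof (fun w => exists i u, i ∈ pow U /\ u ∈ U /\ w = opair i u)).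
  { intros i u Hi Hu; apply (setofE HW); eauto. }
  exists E; split; [split; auto|]; intros A Z HAZ HZ X HX.
  assert (Hcol : exists i, i ∈ pow U /\ forall u a, u ∈ U -> a ∈ E ->
    opair (opair i u) a ∈ k -> ~ a ∈ A).
  { apply NNPP; intro Hn.
    destruct (equinumerous_elim HAZ) as (h & H1 & H2 & H3 & H4).
    (* The diagonal set of Cantor's argument. *)
    set (Q := fun u => u ∈ Z /\ exists a i v, a ∈ A /\ a ∈ E /\ opair a u ∈ h /\
      i ∈ pow U /\ v ∈ U /\ opair (opair i v) a ∈ k /\ ~ u ∈ i).
    assert (HD : small Q).
    { apply small_separation with Z; [unfold Q; dfn|unfold Q; tauto]. }
    assert (Hd : setof Q ∈ pow U).
    { apply powE; split; [now apply set_setof|].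
      intros u Hu; apply (setofE HD) in Hu; apply HZ, Hu. }
    apply Hn; exists (setof Q); split; auto; intros v a Hv HaE Hk HaA.
    destruct (H1 a HaA) as (u & Hu & Hau).
    assert (Hnot : ~ u ∈ setof Q).
    { intro Hin; pose proof Hin as Hin'; apply (setofE HD) in Hin'.
      destruct Hin' as (_ & a' & i & v' & Ha' & HaE' & Ha'u & Hi & Hv' & Hk' & Hui).
      assert (a' = a) by eauto; subst a'.
      assert (Eo : opair i v' = opair (setof Q) v) by (apply (K4 _ _ a); auto).
      apply opair_inj in Eo; destruct Eo as [-> _]; contradiction. }
    apply Hnot, (setofE HD); split; auto; exists a, (setof Q), v; repeat split; auto. }
  destruct Hcol as (i & Hi & Hcol).
  set (Q := fun a => a ∈ E /\ exists u, u ∈ X /\ opair (opair i u) a ∈ k).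
  assert (HQ : small Q).
  { apply small_separation with E; [unfold Q; dfn|unfold Q; tauto]. }
  assert (QE : forall a, a ∈ setof Q -> a ∈ E /\ exists u, u ∈ X /\ opair (opair i u) a ∈ k).
  { intros a Ha; now apply (setofE HQ) in Ha. }
  exists (setof Q); split; [split; [now apply set_setof|]|split; [|split]].
  - intros a Ha; apply QE in Ha; apply UE, Ha.
  - intros a Ha; apply QE in Ha; apply Ha.
  - intros a Ha; apply QE in Ha; destruct Ha as (HaE & u & Hu & Hk); eauto.
  - apply equinumerous_intro with (fun u a => opair (opair i u) a ∈ k); [dfn|].
    split; [|split; [|split]].
    + intros u Hu; destruct (K1 (opair i u)) as (a & Ha & Hk); auto.
      exists a; split; auto; apply (setofE HQ); split; eauto.
    + intros a Ha; apply QE in Ha; apply Ha.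
    + intros u a a' Hu Ha Ha'; apply QE in Ha, Ha'; apply K3; intuition auto.
    + intros u u' a Hu Hu' Ha H H'; apply QE in Ha.
      assert (Eo : opair i u = opair i u') by (apply (K4 _ _ a); intuition auto).
      now apply opair_inj in Eo.
Qed.

Lemma fresh_copy_exists D X : exists Y, urset Y /\
  (forall a, a ∈ Y -> ~ a ∈ D) /\ equinumerous X Y.
Proof.
  destruct (rich_urset_exists (un2 D X)) as (E & _ & HE).
  destruct (HE D D (equinumerous_refl D)) with (X := X) as (Y & HY & _ & H1 & H2).
  1,2: intros a Ha; apply un2E; auto.
  now exists Y.
Qed.

(** If [X] and [Y] meet they cannot be swapped at once, so the move goes through
    a copy disjoint from both. *)
Lemma aut_of_equinumerous A X Y : urset A -> urset X -> urset Y -> equinumerous X Y ->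
  (forall a, a ∈ A -> ~ a ∈ X) -> (forall a, a ∈ A -> ~ a ∈ Y) ->
  exists f g, aut f g /\ f X = Y /\ forall a, a ∈ A -> f a = a.
Proof.
  intros UA UX UY E HX HY.
  destruct (fresh_copy_exists (un2 A (un2 X Y)) X) as (W & UW & HW & EW).
  assert (HW' : forall a, a ∈ W -> ~ a ∈ A /\ ~ a ∈ X /\ ~ a ∈ Y).
  { intros a Ha; specialize (HW a Ha); rewrite !un2E in HW; tauto. }
  destruct (@aut_of_swap X W UX UW) as (f & F & Hf & Ff); auto.
  { intros a Ha Hw; now destruct (HW' a Hw) as (? & ? & ?). }
  destruct (@aut_of_swap W Y UW UY) as (f' & F' & Hf' & Ff').
  { intros a Hw Ha; now destruct (HW' a Hw) as (? & ? & ?). }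
  { eapply equinumerous_trans; [apply equinumerous_sym|]; eauto. }
  exists (fun x => f' (f x)), (fun x => f (f' x)); split; [now apply aut_comp|split].
  - now rewrite Hf.
  - intros a Ha; assert (~ a ∈ W) by (intro K; now destruct (HW' a K)).
    destruct UA as (_ & UA).
    rewrite Ff, Ff'; auto.
Qed.

(** * Cardinals *)

Section Cardinals.
Context (card : formula) (p : M).
Context (card_fun : forall x, is_set x -> exists! c : M, sat3 card x c p).
Context (card_eq : forall x y, is_set x -> is_set y ->
  equinumerous x y <-> exists c : M, sat3 card x c p /\ sat3 card y c p).

Definition has_card x c : Prop := is_set x /\ sat3 card x c p.

Lemma pdef_has_card t1 t2 : tdef t1 -> tdef t2 -> pdef (fun r => has_card (t1 r) (t2 r)).
Proof.
  apply pdef_rel2; unfold has_card; dfn.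
  apply (pdef_iff (pdef_val (fun i => match i with 0 => inl 0 | 1 => inl 1 | _ => inr p end)
    (pdef_sat card))).
  intro r; apply sat_ext; now intros [|[|i]].
Qed.

Lemma has_card_ex x : is_set x -> exists c, has_card x c.
Proof. intro Sx; destruct (card_fun Sx) as (c & Hc & _); exists c; now split. Qed.

Lemma has_card_unique x c d : has_card x c -> has_card x d -> c = d.
Proof.
  intros (Sx & Hc) (_ & Hd); destruct (card_fun Sx) as (e & _ & U).
  now rewrite <- (U c Hc), <- (U d Hd).
Qed.

Lemma has_card_equinumerous x y c : has_card x c -> has_card y c -> equinumerous x y.
Proof. intros (Sx & Hx) (Sy & Hy); apply card_eq; eauto. Qed.

Lemma has_card_transfer x y c : has_card x c -> is_set y -> equinumerous x y -> has_card y c.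
Proof.
  intros Hx Sy E; pose proof Hx as (Sx & _); apply card_eq in E; auto.
  destruct E as (d & Hd & Hd'); rewrite (@has_card_unique x c d); auto; now split.
Qed.

(** The urelements on which [p] depends. *)
Context (A0 j0 : M) (UA0 : urset A0) (Hp : p ∈ V A0 j0).

(** An automorphism that fixes [A0] pointwise fixes [p], and moves each set to
    an equinumerous one, so it fixes every cardinal; but all urelements outside
    [A0] on which a cardinal depends can be moved away. *)
Lemma card_in_V x c : has_card x c -> exists j, c ∈ V A0 j.
Proof.
  intro Hc; destruct (V_cover c) as (K & j & UK & HK); exists j.
  assert (HS : small (fun a => a ∈ K /\ ~ a ∈ A0)).
  { apply small_separation with K; [dfn|tauto]. }
  set (K1 := setof (fun a => a ∈ K /\ ~ a ∈ A0)).
  assert (K1E : forall a, a ∈ K1 <-> a ∈ K /\ ~ a ∈ A0) by apply (setofE HS).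
  assert (UK1 : urset K1).
  { apply urset_sub with K; auto; [exact (set_setof HS)|]; intros a Ha; now apply K1E. }
  destruct (fresh_copy_exists (un2 K A0) K1) as (Y & UY & HY & EY).
  setoid_rewrite un2E in HY.
  destruct (aut_of_swap UK1 UY) as (f & F & Hf & Ff); auto.
  { intros a Ha HaY; apply K1E in Ha; apply (HY a HaY); tauto. }
  assert (FA : forall a, a ∈ A0 -> f a = a).
  { intros a Ha; apply Ff; [now apply UA0| |].
    - intro H; apply K1E in H; tauto.
    - intro H; apply (HY a H); auto. }
  assert (Ep : f p = p) by apply (aut_fix_V F FA Hp).
  assert (Ec : f c = c).
  { apply has_card_unique with (f x).
    - destruct Hc as (Sx & Hc); split; [now apply (aut_set F)|].
      unfold sat3 in *; apply (aut_sat card F) in Hc.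
      refine (proj1 (sat_ext card _) Hc); now intros [|[|i]].
    - apply has_card_transfer with x; auto.
      + apply (aut_set F), Hc.
      + apply (aut_equinumerous x F). }
  apply V_inter with K (f K) j; auto; [now apply (aut_urset F)| |].
  - intros a Ha Ha'; apply (aut_memE _ _ F) in Ha'; apply NNPP; intro Hn.
    apply (HY (f a)); auto; rewrite <- Hf; apply (aut_mem F), K1E; auto.
  - rewrite <- Ec; now apply (aut_V F).
Qed.

(** ** Sets of urelements of bounded size *)

(** Comparing [A] with subsets of sets whose cardinals are in [l] makes the notion
    closed under subsets. *)
Definition bounded l A : Prop := urset A /\
  exists c x z, c ∈ l /\ has_card x c /\ sub z x /\ equinumerous A z.

Lemma pdef_bounded t1 t2 : tdef t1 -> tdef t2 -> pdef (fun r => bounded (t1 r) (t2 r)).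
Proof.
  apply pdef_rel2; unfold bounded, urset; dfn; apply pdef_has_card; dfn.
Qed.

Ltac dfn_rel ::= first [apply pdef_equinumerous | apply pdef_has_card | apply pdef_bounded].

Lemma bounded_mono l m A : sub l m -> bounded l A -> bounded m A.
Proof. intros Hlm (UA & c & x & z & Hc & H); split; auto; exists c, x, z; auto. Qed.

Lemma bounded_sub l A B : bounded l A -> is_set B -> sub B A -> bounded l B.
Proof.
  intros (UA & c & x & z & Hc & Hx & Hz & E) SB HB; split; [now apply urset_sub with A|].
  destruct (equinumerous_sub E HB) as (z' & _ & Hz' & E').
  exists c, x, z'; split; auto; split; auto; split; auto.
  intros w Hw; auto.
Qed.

Lemma bounded_equinumerous l A B : bounded l A -> urset B -> equinumerous B A -> bounded l B.
Proof.
  intros (UA & c & x & z & Hc & Hx & Hz & E) UB EB; split; auto.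
  exists c, x, z; split; auto; split; auto; split; auto.
  now apply equinumerous_trans with A.
Qed.

(** By Plenitude each cardinal in [l] is attained by a set of urelements;
    Collection gathers such sets, and [U] is their union. *)
Lemma universal_urset_exists l : exists U, urset U /\
  forall A, bounded l A -> exists Z, urset Z /\ sub Z U /\ equinumerous A Z.
Proof.
  destruct (@collect (fun c X => forall x, has_card x c -> urset X /\ has_card X c) l)
    as (v & Hv).
  { unfold urset; dfn. }
  { intros c _; destruct (classic (exists x, has_card x c)) as [(x & Hx)|Hn].
    - destruct (plen (proj1 Hx)) as (X & SX & UX & E); exists X; intros _ _.
      split; [now split|]; now apply has_card_transfer with x.
    - exists c; intros x Hx; destruct Hn; eauto. }
  assert (HS : small (fun a => exists X, X ∈ v /\ urset X /\ a ∈ X)).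
  { apply small_separation with (Un v); [unfold urset; dfn|].
    intros a (X & HX & _ & Ha); apply UnE; eauto. }
  exists (setof (fun a => exists X, X ∈ v /\ urset X /\ a ∈ X)); split.
  { split; [now apply set_setof|]; intros a Ha; apply (setofE HS) in Ha.
    destruct Ha as (X & _ & (_ & HX) & Ha); auto. }
  intros A (UA & c & x & z & Hc & Hx & Hz & E).
  destruct (Hv c Hc) as (X & HX & HcX); destruct (HcX x Hx) as (UX & HXc).
  destruct (equinumerous_sub (has_card_equinumerous Hx HXc) Hz) as (Z & SZ & HZ & EZ).
  exists Z; split; [now apply urset_sub with X|split].
  - intros a Ha; apply (setofE HS); eauto.
  - now apply equinumerous_trans with z.
Qed.

(** * Quantification over tuples *)

(** The values of [n] additional variables are put in front of an environment. *)
Fixpoint prepend (n : nat) (r s : nat -> M) : nat -> M :=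
  match n with O => s | S k => prepend k r (scons (r k) s) end.

Lemma prepend_ge n : forall (r s : nat -> M) i, prepend n r s (n + i) = s i.
Proof.
  induction n as [|n IH]; intros r s i; simpl; auto.
  replace (S (n + i)) with (n + S i) by lia; now rewrite IH.
Qed.

Lemma prepend_lt n : forall (r s : nat -> M) i, i < n -> prepend n r s i = r i.
Proof.
  induction n as [|n IH]; intros r s i Hi; [lia|simpl].
  destruct (Nat.eq_dec i n) as [->|Hn]; [|apply IH; lia].
  pose proof (prepend_ge n r (scons (r n) s) 0) as H; now rewrite Nat.add_0_r in H.
Qed.

Lemma pdef_ext (P : (nat -> M) -> Prop) (r s : nat -> M) :
  pdef P -> (forall i, r i = s i) -> P r -> P s.
Proof.
  intros (f & v & H) E; rewrite !H; apply sat_ext; intro i; unfold val.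
  now destruct (v i).
Qed.

Lemma prepend_ext n (r r' s s' : nat -> M) : (forall i, i < n -> r i = r' i) ->
  (forall i, s i = s' i) -> forall i, prepend n r s i = prepend n r' s' i.
Proof.
  intros Hr Hs i; destruct (Nat.lt_ge_cases i n) as [Hi|Hi].
  - rewrite !prepend_lt; auto.
  - replace i with (n + (i - n)) by lia; now rewrite !prepend_ge.
Qed.

Lemma pdef_all_tuple n (P : (nat -> M) -> Prop) :
  pdef P -> pdef (fun s => forall r, P (prepend n r s)).
Proof.
  intro HP; induction n as [|n IH]; simpl.
  - apply (pdef_iff HP); intro s; split; auto; intro H; apply (H s).
  - apply pdef_iff with (fun s => forall a, forall r, P (prepend n r (scons a s))).
    + apply pdef_all; apply (pdef_iff IH); intro s; split; intros H r;
        refine (pdef_ext HP _ (H r)); apply prepend_ext; auto; now intros [|i].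
    + intro s; split; [intros H r; apply H|].
      intros H a r; specialize (H (fun i => if Nat.eqb i n then a else r i)).
      revert H; apply (pdef_ext HP); rewrite Nat.eqb_refl; apply prepend_ext; auto.
      intros i Hi; destruct (Nat.eqb_spec i n); auto; lia.
Qed.

(** Only finitely many entries of the environment of a formula matter, so a
    quantifier over all environments is definable as well. *)
Lemma pdef_all_env n (P : (nat -> M) -> M -> M -> Prop) :
  pdef (fun r => P r (r n) (r (n + 1))) ->
  (forall r r' a b, (forall i, i < n -> r i = r' i) -> P r a b -> P r' a b) ->
  pdef (fun s => forall r, P r (s 0) (s 1)).
Proof.
  intros DP HP; apply (pdef_iff (pdef_all_tuple n DP)); intro s.
  assert (E0 : forall r, prepend n r s n = s 0).
  { intro r; pose proof (prepend_ge n r s 0) as H; now rewrite Nat.add_0_r in H. }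
  split; intros H r; specialize (H r).
  - rewrite E0, prepend_ge in H; revert H; apply HP; apply prepend_lt.
  - rewrite E0, prepend_ge; revert H; apply HP; intros i Hi; now rewrite prepend_lt.
Qed.

Lemma pdef_forall_lt n (P : nat -> (nat -> M) -> Prop) :
  (forall i, i < n -> pdef (P i)) -> pdef (fun r => forall i, i < n -> P i r).
Proof.
  induction n as [|n IH]; intro H.
  - apply (pdef_iff (pdef_const True)); intro r; split; auto; intros _ i Hi; lia.
  - apply pdef_iff with (fun r => (forall i, i < n -> P i r) /\ P n r).
    + apply pdef_and; auto.
    + intro r; split; [|intro K; split; auto].
      intros (K & K') i Hi; destruct (Nat.eq_dec i n) as [->|Hn]; auto; apply K; lia.
Qed.

Lemma pdef_forall_In (I : Type) (L : list I) (P : I -> (nat -> M) -> Prop) :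
  (forall i, In i L -> pdef (P i)) -> pdef (fun r => forall i, In i L -> P i r).
Proof.
  induction L as [|i L IH]; intro H.
  - apply (pdef_iff (pdef_const True)); intro r; simpl; tauto.
  - apply pdef_iff with (fun r => P i r /\ forall j, In j L -> P j r).
    + apply pdef_and; [|apply IH; intros]; apply H; simpl; auto.
    + intro r; simpl; split.
      * intros (K & K') j [<-|Hj]; auto.
      * intro K; split; auto.
Qed.

Lemma pdef_sat_scons (h : formula) (t : (nat -> M) -> M) k : tdef t ->
  pdef (fun r => sat (scons (t r) (fun i => r (k + i))) h).
Proof.
  intro Ht; apply (pdef_subst (Q := fun y r => sat (scons y (fun i => r (k + i))) h) Ht).
  apply (pdef_iff (pdef_ren (fun i => match i with O => O | S j => S (k + j) end)
    (pdef_sat h))).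
  intro r; apply sat_ext; now intros [|i].
Qed.

Lemma sat_scons_agree (h : formula) n y (r s : nat -> M) : vars_below (S n) h ->
  (forall i, i < n -> r i = s i) -> sat (scons y r) h -> sat (scons y s) h.
Proof.
  intros Hv H; apply (proj1 (sat_agree Hv (s := scons y s) (r := scons y r)
    ltac:(intros [|i] Hi; simpl; auto; apply H; lia))).
Qed.

(** Tuples are coded by objects so that Collection applies to them. *)
Fixpoint code (n : nat) (r : nat -> M) : M :=
  match n with O => empty | S k => opair (r k) (code k r) end.

Lemma code_inj n (r s : nat -> M) : code n r = code n s -> forall i, i < n -> r i = s i.
Proof.
  induction n as [|n IH]; simpl; intros E i Hi; [lia|].
  apply opair_inj in E; destruct E as [E1 E2].
  destruct (Nat.eq_dec i n) as [->|Hn]; auto; apply IH; auto; lia.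
Qed.

Lemma code_ext n (r s : nat -> M) : (forall i, i < n -> r i = s i) -> code n r = code n s.
Proof. induction n as [|n IH]; simpl; intro H; auto; rewrite H, IH; auto. Qed.

Lemma codes_small n A : exists T, forall r, (forall i, i < n -> r i ∈ A) -> code n r ∈ T.
Proof.
  induction n as [|n (T & HT)]; simpl.
  - exists (sing empty); intros r _; now apply singE.
  - exists (pow (pow (un2 A T))); intros r Hr; apply opair_pow; apply un2E; [auto|].
    right; apply HT; intros i Hi; apply Hr; lia.
Qed.

Lemma tdef_code n : tdef (code n).
Proof.
  induction n as [|n IH]; [apply tdef_const|].
  apply (tdef_opair (t1 := fun r => r n) (t2 := code n)); auto; apply tdef_var.
Qed.

Lemma collect_tuple (h : formula) n A : vars_below (S n) h ->
  exists v, forall r, (forall i, i < n -> r i ∈ A) ->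
    (exists y, sat (scons y r) h) -> exists y, y ∈ v /\ sat (scons y r) h.
Proof.
  intro Hv; destruct (codes_small n A) as (T & HT).
  set (R := fun t y => forall r, t = code n r ->
    (exists y', sat (scons y' r) h) -> sat (scons y r) h).
  destruct (@collect R T) as (v & Hc).
  { unfold R; apply (pdef_all_env (n := n) (P := fun r t y => t = code n r ->
      (exists y', sat (scons y' r) h) -> sat (scons y r) h)).
    - dfn.
      + apply tdef_code.
      + apply (pdef_sat_scons h 1); dfn.
      + apply (pdef_sat_scons h 0); dfn.
    - intros r r' t y Hr H E (y' & Hy').
      assert (Hr' : forall i, i < n -> r' i = r i) by (intros; symmetry; auto).
      apply (sat_scons_agree Hv Hr), H; [now rewrite (code_ext Hr)|].
      exists y'; revert Hy'; now apply (sat_scons_agree Hv). }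
  { intros t _; destruct (classic (exists r y, t = code n r /\ sat (scons y r) h))
      as [(r & y & -> & Hy)|Hn].
    - exists y; intros r' E _; revert Hy; apply (sat_scons_agree Hv); now apply code_inj.
    - exists t; intros r -> (y & Hy); destruct Hn; eauto. }
  exists v; intros r Hr Hy; destruct (Hc _ (HT r Hr)) as (y & Hyv & K).
  exists y; split; auto.
Qed.

(** * Stages that contain witnesses *)

Ltac dfn_rel ::=
  first [ apply pdef_equinumerous | apply pdef_has_card | apply pdef_bounded
        | apply pdef_forall_lt; intros ? _
        | apply (pdef_sat_scons _ 1) | apply (@pdef_sat_scons _ _ 2)
        | apply (pdef_sat_scons _ 3) ].

(** The levels are the stages over [A0], among which all cardinals appear. *)
Definition level l : Prop := exists j, l = V A0 j.

(** Here [X] is the set of new urelements on which the witness depends.  Since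
    only the sizes of [A] and [X] are bounded, this holds for all [A] of a given
    size as soon as it holds for one of them. *)
Definition witnessed n (h : formula) l m : Prop :=
  forall r A, bounded l A -> (forall i, i < n -> r i ∈ V A l) ->
  (exists y, sat (scons y r) h) ->
  exists X y, bounded m X /\ (forall a, a ∈ X -> ~ a ∈ A) /\
    y ∈ V (un2 A X) m /\ sat (scons y r) h.

Lemma pdef_witnessed n h : vars_below (S n) h ->
  pdef (fun s => witnessed n h (s 0) (s 1)).
Proof.
  intro Hv; unfold witnessed.
  apply (pdef_all_env (n := n) (P := fun r l m => forall A, bounded l A ->
    (forall i, i < n -> r i ∈ V A l) -> (exists y, sat (scons y r) h) ->
    exists X y, bounded m X /\ (forall a, a ∈ X -> ~ a ∈ A) /\
      y ∈ V (un2 A X) m /\ sat (scons y r) h)).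
  - dfn.
  - intros r r' l m Hr H A HA Hr' (y & Hy).
    assert (Hs : forall i, i < n -> r' i = r i) by (intros; symmetry; auto).
    destruct (H A HA) as (X & y' & HX & HD & Hy' & K).
    + intros i Hi; rewrite Hr; auto.
    + exists y; revert Hy; now apply (sat_scons_agree Hv).
    + exists X, y'; split; [|split; [|split]]; auto; revert K; now apply (sat_scons_agree Hv).
Qed.

Lemma witnessed_mono n h l m m' : sub m m' -> witnessed n h l m -> witnessed n h l m'.
Proof.
  intros Hm H r A HA Hr Hy; destruct (H r A HA Hr Hy) as (X & y & HX & HD & HV & K).
  exists X, y; split; [apply (bounded_mono Hm HX)|split; [|split]]; auto.
  revert HV; apply V_mono; auto; now intros ?.
Qed.

(** If [E] is rich enough, then [A] and the rest of [B] have disjoint copies in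
    [E], so the size of [E] bounds that of their union. *)
Lemma level_has_unions l : exists j, forall m, sub (V A0 j) m ->
  forall A B, bounded l A -> bounded l B -> bounded m (un2 A B).
Proof.
  destruct (universal_urset_exists l) as (U & UU & HU).
  destruct (rich_urset_exists U) as (E & UE & HE).
  destruct (has_card_ex (proj1 UE)) as (c & Hc).
  destruct (card_in_V Hc) as (j & Hj); exists j; intros m Hm A B HA HB.
  assert (HS : small (fun a => a ∈ B /\ ~ a ∈ A)).
  { apply small_separation with B; [dfn|tauto]. }
  set (B1 := setof (fun a => a ∈ B /\ ~ a ∈ A)).
  assert (B1E : forall a, a ∈ B1 <-> a ∈ B /\ ~ a ∈ A) by apply (setofE HS).
  assert (HB1 : bounded l B1).
  { apply bounded_sub with B; auto; [exact (set_setof HS)|].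
    intros a Ha; now apply B1E. }
  destruct (HU A HA) as (Z & UZ & HZ & EZ), (HU B1 HB1) as (Z1 & UZ1 & HZ1 & EZ1).
  destruct (HE Z Z (equinumerous_refl Z) HZ Z HZ) as (Y & UY & HY & _ & EY).
  destruct (HE Y Z (equinumerous_sym EY) HZ Z1 HZ1) as (Y1 & UY1 & HY1 & DY & EY1).
  assert (EU : un2 A B = un2 A B1).
  { apply set_ext; auto using set_un2; intro a; rewrite !un2E, B1E.
    destruct (classic (a ∈ A)); tauto. }
  split; [split; [apply set_un2|]|].
  { intros a Ha; apply un2E in Ha; destruct Ha; [apply HA|apply HB]; auto. }
  exists c, E, (un2 Y Y1); split; [now apply Hm|split; auto; split].
  - intros a Ha; apply un2E in Ha; destruct Ha; auto.
  - rewrite EU; apply equinumerous_union.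
    + now apply equinumerous_trans with Z.
    + now apply equinumerous_trans with Z1.
    + intros a Ha Ha'; apply B1E in Ha'; tauto.
    + intros a Ha Ha'; exact (DY a Ha' Ha).
Qed.

(** Every [A] of bounded size can be moved into one set [U].  Witnesses for all
    tuples over [U] are collected into one [V K j1] and moved back, which changes
    [K] only to an equinumerous set. *)
Lemma level_has_witnesses n h l : vars_below (S n) h ->
  exists j, forall m, sub (V A0 j) m -> witnessed n h l m.
Proof.
  intro Hv; destruct (universal_urset_exists l) as (U & UU & HU).
  destruct (collect_tuple (V U l) Hv) as (v & Hcol).
  destruct (V_cover v) as (K & j1 & UK & HK).
  destruct (has_card_ex (proj1 UK)) as (c & Hc).
  destruct (card_in_V Hc) as (j & Hj); exists (un2 j j1); intros m Hm r A HA Hr (y & Hy).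
  destruct (HU A HA) as (Z & UZ & HZ & EZ).
  assert (Ue : urset empty).
  { split; [apply set_empty|]; intros a Ha; destruct (emptyE Ha). }
  destruct (aut_of_equinumerous Ue (proj1 HA) UZ EZ) as (f & g & F & Ef & _);
    [intros a Ha; destruct (emptyE Ha)..|].
  destruct (Hcol (fun i => f (r i))) as (y' & Hyv & Hy').
  { intros i Hi; apply (@V_mono Z U l l HZ); [now intros ?|].
    rewrite <- Ef; apply (aut_V F); auto. }
  { exists (f y); apply (aut_sat h F) in Hy; revert Hy; apply sat_ext; now intros [|i]. }
  assert (HyV : g y' ∈ V (g K) m).
  { apply (aut_V (aut_sym F)).
    apply (@V_mono K K (V A0 j1) m); [now intros ?| |].
    - intros w Hw; apply Hm; revert Hw; apply V_mono; [now intros ?|].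
      intros i Hi; apply un2E; auto.
    - apply V_index, (V_transitive UK HK Hyv). }
  assert (HgK : bounded m (g K)).
  { apply bounded_equinumerous with K.
    - split; auto; exists c, K, K; split; [|split; auto; split].
      + apply Hm; revert Hj; apply V_mono; [now intros ?|].
        intros w Hw; apply un2E; auto.
      + now intros ?.
      + apply equinumerous_refl.
    - now apply (aut_urset (aut_sym F)).
    - apply equinumerous_sym, (aut_equinumerous K (aut_sym F)). }
  assert (HS : small (fun a => a ∈ g K /\ ~ a ∈ A)).
  { apply small_separation with (g K); [dfn|tauto]. }
  exists (setof (fun a => a ∈ g K /\ ~ a ∈ A)), (g y'); split; [|split; [|split]].
  - apply bounded_sub with (g K); auto; [now apply set_setof|].
    intros a Ha; apply (setofE HS) in Ha; tauto.
  - intros a Ha; apply (setofE HS) in Ha; tauto.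
  - revert HyV; apply V_mono; [|now intros ?].
    intros a Ha; apply un2E; rewrite (setofE HS); tauto.
  - apply (aut_sat h (aut_sym F)) in Hy'; revert Hy'; apply sat_agree with (S n); auto.
    intros [|i] Hi; simpl; auto; symmetry; apply (aut_cancel F).
Qed.

Lemma level_has_all_witnesses (L : list (nat * formula)) l :
  (forall n h, In (n, h) L -> vars_below (S n) h) ->
  exists j, forall m, sub (V A0 j) m -> forall n h, In (n, h) L -> witnessed n h l m.
Proof.
  intro HL; induction L as [|[n h] L IH]; [now exists empty|].
  destruct IH as (k & Hk); [intros; apply HL; simpl; auto|].
  destruct (@level_has_witnesses n h l) as (k' & Hk'); [apply HL; simpl; auto|].
  exists (un2 k k'); intros m Hm n' h' Hin.
  assert (sub (V A0 k) m /\ sub (V A0 k') m) as [Hm1 Hm2].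
  { split; intros w Hw; apply Hm; revert Hw; (apply V_mono; [now intros ?|]);
      intros u Hu; apply un2E; auto. }
  destruct Hin as [E|Hin]; [injection E as <- <-|]; auto.
Qed.

Section Requirements.
Context (L : list (nat * formula)).
Context (HL : forall n h, In (n, h) L -> vars_below (S n) h).

(** The hypothesis makes the condition void when [l] is not a level, so that a least
    good [m] exists for every object [l], as iteration requires. *)
Definition good l m : Prop := level l -> sub l m /\
  (forall A B, bounded l A -> bounded l B -> bounded m (un2 A B)) /\
  forall n h, In (n, h) L -> witnessed n h l m.

Lemma pdef_good t1 t2 : tdef t1 -> tdef t2 -> pdef (fun r => good (t1 r) (t2 r)).
Proof.
  apply pdef_rel2; unfold good, level; dfn.
  apply pdef_iff with
    (fun r => forall q, In q L -> witnessed (fst q) (snd q) (r 0) (r 1)).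
  - apply pdef_forall_In; intros [n h] Hin; apply pdef_witnessed; auto.
  - intro r; split; [intros H n h Hin; exact (H (n, h) Hin)|].
    intros H [n h] Hin; auto.
Qed.

Lemma good_mono l m m' : sub m m' -> good l m -> good l m'.
Proof.
  intros Hm H Hl; destruct (H Hl) as (H1 & H2 & H3); split; [|split].
  - intros x Hx; auto.
  - intros A B HA HB; apply (bounded_mono Hm); auto.
  - intros n h Hin; apply (witnessed_mono Hm); auto.
Qed.

Lemma good_level_exists l : exists j, good l (V A0 j).
Proof.
  destruct (classic (level l)) as [(j & ->)|Hn]; [|exists empty; intro; contradiction].
  destruct (level_has_unions (V A0 j)) as (j' & Hj').
  destruct (level_has_all_witnesses (V A0 j) HL) as (k & Hk).
  exists (un2 j (un2 j' k)); intros _.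
  assert (Hs : forall i, sub i (un2 j (un2 j' k)) -> 
    sub (V A0 i) (V A0 (un2 j (un2 j' k)))).
  { intros i Hi; apply V_mono; auto; now intros ?. }
  split; [|split].
  - apply Hs; intros w Hw; apply un2E; auto.
  - apply Hj', Hs; intros w Hw; rewrite !un2E; auto.
  - apply Hk, Hs; intros w Hw; rewrite !un2E; auto.
Qed.

(** [m] is the least good level, expressed by the minimality of its index. *)
Definition is_next l m : Prop := exists y, m = V A0 y /\ good l m /\
  forall z, z ∈ y -> ~ good l (V A0 z).

(** Minimal indices of good levels give the same level because levels are
    comparable and goodness is inherited by larger ones. *)
Lemma next_exists_unique l : exists! m, is_next l m.
Proof.
  assert (HE : exists y, good l (V A0 y) /\ forall z, z ∈ y -> ~ good l (V A0 z)).
  { apply NNPP; intro Hn; destruct (good_level_exists l) as (j & Hj).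
    revert j Hj; apply (mem_ind (P := fun j => good l (V A0 j) -> False)).
    - dfn; apply pdef_good; dfn.
    - intros y IH Hy; apply Hn; now exists y. }
  destruct HE as (y & Hy & Hmin); exists (V A0 y); split; [now exists y|].
  assert (Hle : forall y z, good l (V A0 z) ->
    (forall y', y' ∈ y -> ~ good l (V A0 y')) -> sub (V A0 y) (V A0 z)).
  { intros u z Hz Hu; destruct (V_compare A0 u z) as [H|(y' & Hy' & H)]; auto.
    destruct (Hu y' Hy'); revert Hz; now apply good_mono. }
  intros m (z & -> & Hz & Hzmin); apply set_ext; try apply set_V.
  intro w; split; apply Hle; auto.
Qed.

Definition next l := the (fun m => is_next l m).

Lemma next_spec l : is_next l (next l).
Proof.
  apply (the_spec (P := fun m => is_next l m)).
  destruct (next_exists_unique l) as (m & Hm & _); eauto.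
Qed.

Lemma tdef_next : tdef (fun r => next (r 0)).
Proof.
  apply (tdef_the (P := fun m r => is_next (r 0) m)).
  - unfold is_next; dfn; apply pdef_good; dfn.
  - intro r; apply next_exists_unique.
Qed.

(** A finite tuple over [t] lies in one [V A l], because the levels in [Lam] form a
    chain and bounded sets have bounded unions.  Its witness depends on a set [X]
    of further urelements, which an automorphism fixing the tuple moves into
    [E]. *)
Lemma reflecting_set_exists x : is_set x ->
  exists t, is_set t /\ transitive t /\ sub x t /\
  forall n h, In (n, h) L -> forall r, (forall i, i < n -> r i ∈ t) ->
    (exists y, sat (scons y r) h) -> exists y, y ∈ t /\ sat (scons y r) h.
Proof.
  intro Sx; destruct (V_cover x) as (A1 & j1 & UA1 & Hx).
  destruct (has_card_ex (proj1 UA1)) as (c1 & Hc1).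
  destruct (card_in_V Hc1) as (j & Hj).
  set (l0 := V A0 (un2 j j1)).
  destruct (closed_set_exists l0 tdef_next) as (Lam0 & _ & Hl0 & Hnext).
  assert (HS : small (fun l => l ∈ Lam0 /\ level l)).
  { apply small_separation with Lam0; [unfold level; dfn|tauto]. }
  set (Lam := setof (fun l => l ∈ Lam0 /\ level l)).
  assert (LamE : forall l, l ∈ Lam <-> l ∈ Lam0 /\ level l) by apply (setofE HS).
  assert (l0L : l0 ∈ Lam) by (apply LamE; split; auto; now exists (un2 j j1)).
  assert (nextL : forall l, l ∈ Lam -> next l ∈ Lam /\ good l (next l) /\ level l).
  { intros l Hl; apply LamE in Hl; destruct Hl as (Hl & Hlev).
    destruct (next_spec l) as (y & E & Hg & _); split; auto.
    apply LamE; split; auto; now exists y. }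
  assert (chain : forall l m, l ∈ Lam -> m ∈ Lam -> sub l m \/ sub m l).
  { intros l m Hl Hm; apply LamE in Hl, Hm; destruct Hl as (_ & y & ->), Hm as (_ & z & ->).
    destruct (V_compare A0 y z) as [H|(y' & Hy' & H)]; auto.
    right; intros w Hw; apply (V_mem Hy'); auto. }
  destruct (universal_urset_exists (Un Lam)) as (U & UU & HU).
  assert (subUn : forall l, l ∈ Lam -> sub l (Un Lam)).
  { intros l Hl w Hw; apply UnE; eauto. }
  destruct (rich_urset_exists U) as (E0 & UE0 & HE0).
  set (E := un2 A1 E0).
  assert (HT : small (fun z => exists l A, l ∈ Lam /\ sub A E /\ bounded l A /\ z ∈ V A l)).
  { apply small_separation with (V E (Un Lam)); [dfn|].
    intros z (l & A & Hl & HA & _ & Hz); revert Hz; apply V_mono; auto. }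
  set (t := setof (fun z => exists l A, l ∈ Lam /\ sub A E /\ bounded l A /\ z ∈ V A l)).
  assert (tE : forall z, z ∈ t <->
    exists l A, l ∈ Lam /\ sub A E /\ bounded l A /\ z ∈ V A l) by apply (setofE HT).
  assert (HA1 : bounded l0 A1).
  { split; auto; exists c1, A1, A1; split; [|split; auto; split].
    - revert Hj; apply V_mono; [now intros ?|]; intros w Hw; apply un2E; auto.
    - now intros ?.
    - apply equinumerous_refl. }
  assert (HA1E : sub A1 E) by (intros a Ha; apply un2E; auto).
  exists t; split; [exact (set_setof HT)|split; [|split]].
  - intros y z Hy Hz; apply tE in Hy; apply tE; destruct Hy as (l & A & Hl & HA & HB & Hy).
    exists l, A; split; [|split; [|split]]; auto.
    apply (V_transitive (proj1 HB) Hy Hz).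
  - assert (Hx0 : x ∈ V A1 l0).
    { apply (@V_mono A1 A1 (V A0 j1) l0); [now intros ?| |now apply V_index].
      apply V_mono; [now intros ?|]; intros w Hw; apply un2E; auto. }
    intros z Hz; apply tE; exists l0, A1; split; [|split; [|split]]; auto.
    apply (V_transitive UA1 Hx0 Hz).
  - intros n h Hin r Hr Hy.
    assert (Hstage : forall k, (forall i, i < k -> r i ∈ t) -> exists l A,
      l ∈ Lam /\ sub A E /\ bounded l A /\ forall i, i < k -> r i ∈ V A l).
    { induction k as [|k IH]; intro Hk.
      - exists l0, A1; split; [|split; [|split]]; auto; intros i Hi; lia.
      - destruct IH as (l & A & Hl & HA & HB & H); [intros i Hi; apply Hk; lia|].
        destruct (proj1 (tE (r k))) as (l' & A' & Hl' & HA' & HB' & H'); [apply Hk; lia|].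
        assert (Hmax : exists m, m ∈ Lam /\ sub l m /\ sub l' m).
        { destruct (chain l l') as [C|C]; auto; [exists l'|exists l];
            repeat split; auto; now intros ?. }
        destruct Hmax as (m & Hm & Hlm & Hlm').
        destruct (nextL m Hm) as (Hnm & Hg & Hlev); destruct (Hg Hlev) as (G1 & G2 & _).
        exists (next m), (un2 A A'); split; auto; split; [|split].
        + intros a Ha; apply un2E in Ha; destruct Ha; auto.
        + apply G2; [apply (bounded_mono Hlm HB)|apply (bounded_mono Hlm' HB')].
        + intros i Hi; destruct (Nat.eq_dec i k) as [->|Hne].
          * revert H'; apply V_mono; [|intros w Hw; auto]; intros a Ha; apply un2E; auto.
          * assert (Hik : i < k) by lia; generalize (H i Hik).
            apply V_mono; [|intros w Hw; auto]; intros a Ha; apply un2E; auto. }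
    destruct (Hstage n Hr) as (l & A & Hl & HA & HB & H).
    destruct (nextL l Hl) as (Hnl & Hg & Hlev); destruct (Hg Hlev) as (G1 & G2 & G3).
    destruct (G3 n h Hin r A HB H Hy) as (X & y & HX & DX & HyV & Hsat).
    destruct (HU A (bounded_mono (subUn l Hl) HB)) as (Z & UZ & HZ & EZ).
    destruct (HU X (bounded_mono (subUn _ Hnl) HX)) as (Z1 & UZ1 & HZ1 & EZ1).
    destruct (HE0 A Z EZ HZ Z1 HZ1) as (Y & UY & HYE & DY & EY).
    assert (EXY : equinumerous X Y) by now apply equinumerous_trans with Z1.
    destruct (aut_of_equinumerous (proj1 HB) (proj1 HX) UY EXY) as (f & g & F & Ef & Ff).
    { intros a Ha Ha'; exact (DX a Ha' Ha). }
    { intros a Ha Ha'; exact (DY a Ha' Ha). }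
    exists (f y); split.
    + destruct (nextL _ Hnl) as (Hnnl & Hg' & Hlev'); destruct (Hg' Hlev') as (G1' & G2' & _).
      apply tE; exists (next (next l)), (un2 A Y); split; auto; split; [|split].
      * intros a Ha; apply un2E in Ha; destruct Ha as [Ha|Ha]; auto.
        apply un2E; right; auto.
      * apply G2'; [apply (bounded_mono G1 HB)|].
        apply bounded_equinumerous with X; auto; now apply equinumerous_sym.
      * assert (EU : sub (f (un2 A X)) (un2 A Y)).
        { intros a Ha; apply (aut_memE _ _ F), un2E in Ha; apply un2E.
          destruct Ha as [Ha|Ha].
          - left; rewrite <- (aut_cancel' F a), Ff; auto.
          - right; rewrite <- Ef; now apply (aut_memE _ _ F). }
        apply (V_mono EU G1'), (aut_V F); auto.
    + apply (aut_sat h F) in Hsat; revert Hsat; apply sat_agree with (S n); auto.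
      intros [|i] Hi; simpl; auto; symmetry; apply (aut_fix_V F Ff) with l, H; lia.
Qed.

End Requirements.
End Cardinals.
End SetTheory.

(** * Reflection from witnesses *)

(** The formulas [h], in [k] parameters besides the variable 0, for which [t] has to
    contain witnesses in order to reflect [f]: the matrices of its existential
    subformulas and the negated matrices of its universal ones. *)
Fixpoint requirements (n : nat) (f : formula) : list (nat * formula) :=
  match f with
  | fMem _ _ | fEq _ _ | fUr _ | fFalse => nil
  | fImp g h | fAnd g h | fOr g h => requirements n g ++ requirements n h
  | fAll g => (n, fImp g fFalse) :: requirements (S n) g
  | fEx g => (n, g) :: requirements (S n) g
  end.

Lemma requirements_vars (f : formula) : forall n, vars_below n f ->
  forall k h, In (k, h) (requirements n f) -> vars_below (S k) h.
Proof.
  induction f as [i j|i j|i| |f1 IH1 f2 IH2|f1 IH1 f2 IH2|f1 IH1 f2 IH2|f IH|f IH];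
    simpl; intros n Hv k h Hin; try contradiction.
  1-3: destruct Hv; apply in_app_or in Hin; destruct Hin; eauto.
  1-2: destruct Hin as [E|Hin]; [injection E as <- <-; simpl; auto|eauto].
Qed.

Lemma reflects_of_witnesses (M : structure) (t : M) (f : formula) : forall n,
  vars_below n f ->
  (forall k h, In (k, h) (requirements n f) -> forall r : nat -> M,
    (forall i, i < k -> r i ∈ t) -> (exists y, sat (scons y r) h) ->
    exists y, y ∈ t /\ sat (scons y r) h) ->
  forall r : nat -> M, r n = t -> (forall i, i < n -> r i ∈ t) ->
  sat r f <-> sat r (relativize n f).
Proof.
  induction f as [i j|i j|i| |f1 IH1 f2 IH2|f1 IH1 f2 IH2|f1 IH1 f2 IH2|f IH|f IH];
    simpl; intros n Hv Hw r Hn Hr; try tauto.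
  1-3: destruct Hv as [Hv1 Hv2]; rewrite <- (IH1 n Hv1), <- (IH2 n Hv2);
    auto; try tauto; intros; eapply Hw; eauto; apply in_or_app; eauto.
  - assert (E : forall a, a ∈ t -> sat (scons a r) f <-> sat (scons a r) (relativize (S n) f)).
    { intros a Ha; apply IH; auto.
      - intros k h Hin; apply Hw; auto.
      - intros [|i] Hi; simpl; auto; apply Hr; lia. }
    rewrite Hn; split.
    + intros H a Ha; apply E; auto.
    + intros H; apply NNPP; intro Hne.
      destruct (Hw n (fImp f fFalse) (or_introl eq_refl) r Hr) as (y & Hy & K).
      * apply NNPP; intro Hno; apply Hne; intro a; apply NNPP; intro Ha.
        apply Hno; exists a; exact Ha.
      * apply K, E; auto.
  - assert (E : forall a, a ∈ t -> sat (scons a r) f <-> sat (scons a r) (relativize (S n) f)).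
    { intros a Ha; apply IH; auto.
      - intros k h Hin; apply Hw; auto.
      - intros [|i] Hi; simpl; auto; apply Hr; lia. }
    rewrite Hn; split.
    + intro H; destruct (Hw n f (or_introl eq_refl) r Hr H) as (y & Hy & K).
      exists y; split; auto; now apply E.
    + intros (a & Ha & K); exists a; now apply E.
Qed.

Lemma Collection_RP (M : structure) : ZFU M -> cardinality_definable M ->
  Plenitude_plus M -> Collection M -> RP M.
Proof.
  intros zf (card & p & _ & Hfun & Heq) plen coll n f Hv x Sx.
  destruct (V_cover zf coll p) as (A0 & j0 & UA0 & Hp).
  destruct (reflecting_set_exists coll plen Hfun Heq UA0 Hp
    (requirements_vars Hv) Sx) as (t & St & Tt & Hxt & Ht).
  exists t; repeat split; auto; intro K.
  - now apply (reflects_of_witnesses Hv Ht).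
  - now apply (reflects_of_witnesses Hv Ht) in K.
Qed.

(** * Collection from reflection *)

Lemma relativize_ren (f : formula) : forall k xi,
  relativize (xi k) (ren xi f) = ren xi (relativize k f).
Proof.
  induction f as [i j|i j|i| |f1 IH1 f2 IH2|f1 IH1 f2 IH2|f1 IH1 f2 IH2|f IH|f IH];
    simpl; intros k xi; auto; try (now rewrite IH1, IH2).
  1-2: now rewrite <- (IH (S k) (up xi)).
Qed.

(** One formula stands for two: with equal flags it says [f(x, y, u)], with
    different flags that there is some [y] such that [f(x, y, u)]. *)
Lemma RP_Collection (M : structure) : ZFU M -> RP M -> Collection M.
Proof.
  intros zf rp f Hf w u Hw.
  (* Variables 0 and 1 are the flags, 2, 3 and 4 are [x], [y] and [u]. *)
  set (xi := fun i => S (S i)).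
  set (eta := fun i => match i with 0 => 3 | 1 => 0 | _ => S (S (S i)) end).
  set (F := fAnd (fImp (fEq 0 1) (ren xi f))
    (fImp (fImp (fEq 0 1) fFalse) (fEx (ren eta f)))).
  destruct (rp 5 F) with (x := un2 zf (upair zf w u)
     (upair zf (empty zf) (sing zf (empty zf)))) as (t & St & Tt & Ht & R).
  { cbn; repeat split; try lia; apply (vars_below_ren Hf);
      intros [|[|[|i]]] Hi; unfold xi, eta; lia. }
  { apply set_un2. }
  set (c0 := empty zf) in *; set (c1 := sing zf (empty zf)) in *.
  assert (Ht' : w ∈ t /\ u ∈ t /\ c0 ∈ t /\ c1 ∈ t).
  { repeat split; apply Ht; rewrite un2E, !upairE; auto. }
  destruct Ht' as (wt & ut & c0t & c1t).
  assert (c01 : c0 <> c1).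
  { intro E; apply (@emptyE M zf (empty zf)); fold c0; rewrite E at 2.
    now apply singE. }
  set (env := fun a b x y => scons a (scons b (scons x (scons y (scons u (fun _ => t)))))).
  assert (HR : forall a b x y : M, a ∈ t -> b ∈ t -> x ∈ t -> y ∈ t ->
    sat (env a b x y) F <-> sat (env a b x y) (relativize 5 F)).
  { intros a b x y Ha Hb Hx Hy; apply R; auto.
    intros [|[|[|[|[|i]]]]] Hi; simpl; auto; lia. }
  exists t; intros x Hx; assert (xt : x ∈ t) by (apply (Tt w); auto).
  destruct (Hw x Hx) as (y & Hy).
  assert (H1 : sat (env c0 c1 x x) F).
  { split; [intro E; destruct (c01 E)|intros _; exists y].
    apply sat_ren; revert Hy; apply (sat_agree Hf); intros [|[|[|i]]] Hi; simpl; auto; lia. }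
  apply HR in H1; auto; destruct H1 as (_ & H1).
  destruct H1 as (y' & Hy' & K); [exact c01|].
  change (y' ∈ t) in Hy'; exists y'; split; auto.
  assert (H2 : sat (env c0 c0 x y') (relativize 5 F)).
  { split; [intros _|intro E; destruct E; reflexivity].
    change (sat (env c0 c0 x y') (relativize (xi 3) (ren xi f))).
    change (sat (scons y' (env c0 c1 x x)) (relativize (eta 3) (ren eta f))) in K.
    rewrite relativize_ren, sat_ren in K |- *.
    revert K; apply sat_ext; now intros [|[|[|i]]]. }
  apply HR in H2; auto; destruct H2 as (H2 & _); specialize (H2 eq_refl).
  change (sat (env c0 c0 x y') (ren xi f)) in H2; rewrite sat_ren in H2.
  revert H2; apply (sat_agree Hf).
  intros [|[|[|i]]] Hi; simpl; auto; lia.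
Qed.

Theorem theorem1 (M : structure) (hZFU : ZFU M)
    (hcard : cardinality_definable M) (hplen : Plenitude_plus M) :
  Collection M <-> RP M.
Proof.
  split; [now apply Collection_RP|now apply RP_Collection].
Qed.
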